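(* Let a finite discounted MDP and a feature matrix $\Phi\in\mathbb{R}^{|\mathcal S||\mathcal A|\times p}$ be given (notation as in the context), and let $d$ be a probability distribution on $\mathcal S\times\mathcal A$ with $d(s,a)>0$ for all $(s,a)$. Let $(s_k,a_k,s_k')_{k\ge0}$ be independent with $(s_k,a_k)\sim d$ and $s_k'\sim\mathcal P(\cdot\mid s_k,a_k)$, and put $r_k=r(s_k,a_k,s_k')$. Let $\alpha_k\in(0,1)$ satisfy $\sum_k\alpha_k=\infty$ and $\sum_k\alpha_k^2<\infty$. For $\eta\ge0$ and $\theta_0\in\mathbb{R}^p$ define $$\theta_{k+1}=\theta_k+\alpha_k\Big(\phi(s_k,a_k)\big(r_k+\gamma\max_{a\in\mathcal A}\phi(s_k',a)^\top\theta_k-\phi(s_k,a_k)^\top\theta_k\big)-\eta\theta_k\Big).$$ Let $\mathcal D_{\mathrm{lin}}$ be the set of points at which $\theta\mapsto F(\theta,\pi^g_\theta,d)$ is differentiable. 1) (Asynchronous tabular Q-learning) If $\Phi=I$ (so $p=|\mathcal S||\mathcal A|$) and $\eta=0$, then with probability one $\theta_k$ converges to a solution of $F(\theta,\pi^g_\theta,d)=0$, which is unique. 2) (Linear Q-learning) If $\eta=0$ and $\sup_{\theta\in\mathcal D_{\mathrm{lin}}}\max_{i\in\{1,\dots,p\}}S_i\big(T(\theta,\pi^g_\theta,d)\big)<0$, then with probability one $\theta_k$ converges to the unique solution of $F(\theta,\pi^g_\theta,d)=0$. 3) (Regularized Q-learning) If $\eta>0$ and $\sup_{\theta\in\mathcal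 D_{\mathrm{lin}}}\max_{i\in\{1,\dots,p\}}S_i\big(T(\theta,\pi^g_\theta,d)-\eta I\big)<0$, then with probability one $\theta_k$ converges to the unique solution of $F_\eta(\theta,\pi^g_\theta,d)=0$.
   Context: MDP: $\mathcal S=\{1,\dots,|\mathcal S|\}$ and $\mathcal A=\{1,\dots,|\mathcal A|\}$ are finite state and action sets, $\gamma\in(0,1)$ is the discount factor, $\mathcal P(s'\mid s,a)$ is the transition kernel, $r:\mathcal S\times\mathcal A\times\mathcal S\to\mathbb{R}$ is a bounded reward. A policy is a map from $\mathcal S$ to probability distributions on $\mathcal A$. Vectors/matrices indexed by $\mathcal S\times\mathcal A$ use index $(s-1)|\mathcal A|+a$ for $(s,a)$. $P\in\mathbb{R}^{|\mathcal S||\mathcal A|\times|\mathcal S|}$ has entries $[P]_{(s,a),s'}=\mathcal P(s'\mid s,a)$; $R\in\mathbb{R}^{|\mathcal S||\mathcal A|}$ has entries $[R]_{(s,a)}=\sum_{s'}\mathcal P(s'\mid s,a)r(s,a,s')$; $\Phi\in\mathbb{R}^{|\mathcal S||\mathcal A|\times p}$ has $(s,a)$-row $\phi(s,a)^\top$ with given features $\phi(s,a)\in\mathbb{R}^p$; for a policy $\pi$, $\Pi_\pi\in\mathbb{R}^{|\mathcal S|\times|\mathcal S||\mathcal A|}$ has entries $[\Pi_\pi]_{s,(s',a')}=\pi(a'\mid s)$ if $s'=s$ and $0$ otherwise. $D_d$ is the diagonal matrix with $(s,a)$ diagonal entry $d(s,a)$. The greedy policy $\pi^g_\theta$ is the deterministic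 policy choosing in state $s$ an action in $\arg\max_{a\in\mathcal A}\phi(s,a)^\top\theta$, ties being broken by a fixed rule. For $\theta\in\mathbb{R}^p$ and a policy $\pi$, $$T(\theta,\pi,d)=\gamma\Phi^\top D_d P\Pi_\pi\Phi-\Phi^\top D_d\Phi,\quad F(\theta,\pi,d)=\Phi^\top D_d R+T(\theta,\pi,d)\theta,\quad F_\eta(\theta,\pi,d)=F(\theta,\pi,d)-\eta\theta .$$ For $A\in\mathbb{R}^{n\times n}$, $S_i(A)=[A]_{i,i}+\sum_{j\ne i}|[A]_{i,j}|$. *)

(* Defs.v *)
From HB Require Import structures.
From mathcomp Require Import all_boot all_order all_algebra.
From mathcomp Require Import finmap.
From mathcomp Require Import all_classical all_reals all_analysis.

Set Implicit Arguments.
Unset Strict Implicit.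
Unset Printing Implicit Defensive.
Import Order.TTheory GRing.Theory Num.Theory.
Import numFieldNormedType.Exports.
Local Open Scope classical_set_scope.
Local Open Scope ring_scope.

Record distr (R : realType) (T : finType) := Distr {
  dval :> T -> R;
  dval_ge0 : forall x, 0 <= dval x;
  dval_sum1 : \sum_x dval x = 1 }.

Lemma dirac_ge0 (R : realType) (T : finType) (x y : T) : 0 <= (y == x)%:R :> R.
Proof. exact: ler0n. Qed.

Lemma dirac_sum1 (R : realType) (T : finType) (x : T) :
  \sum_y (y == x)%:R = 1 :> R.
Proof.
by rewrite (bigD1 x) //= eqxx big1 ?addr0 // => y /negbTE ->.
Qed.

Definition dirac_distr (R : realType) (T : finType) (x : T) : distr R T :=
  Distr (@dirac_ge0 R T x) (@dirac_sum1 R T x).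

(* There are nS.+1 states and nA.+1 actions, so that both sets are nonempty.
   Since these sets are finite, the reward is automatically bounded. *)
Record mdp (R : realType) (nS nA : nat) := Mdp {
  discount : R;
  discount_gt0 : 0 < discount;
  discount_lt1 : discount < 1;
  trans : 'I_nS.+1 -> 'I_nA.+1 -> distr R 'I_nS.+1;
  reward : 'I_nS.+1 -> 'I_nA.+1 -> 'I_nS.+1 -> R }.

Definition policy (R : realType) (nS nA : nat) := 'I_nS.+1 -> distr R 'I_nA.+1.

(* In all the matrices below, (s, a) is encoded by mxvec_index s a, whose value
   is s * nA.+1 + a (both s and a being counted from 0); mxvec lists the entries
   of a matrix indexed by states and actions in that order. *)
Section Matrices.
Variables (R : realType) (nS nA p : nat).
Local Notation nSA := (nS.+1 * nA.+1)%N.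
Implicit Types (M : mdp R nS nA) (pi : policy R nS nA).
Implicit Types (d : distr R ('I_nS.+1 * 'I_nA.+1)%type).
Implicit Types (Phi : 'M[R]_(nSA, p)) (theta : 'cV[R]_p).

Definition transition_mx M : 'M[R]_(nSA, nS.+1) :=
  \matrix_(i, s') mxvec (\matrix_(s, a) trans M s a s') 0 i.

Definition reward_vec M : 'cV[R]_nSA :=
  (mxvec (\matrix_(s, a) \sum_s' trans M s a s' * reward M s a s'))^T.

Definition policy_mx pi : 'M[R]_(nS.+1, nSA) :=
  \matrix_(s, j) mxvec (\matrix_(s', a') (if s' == s then pi s a' else 0)) 0 j.

Definition distr_mx d : 'M[R]_nSA :=
  diag_mx (mxvec (\matrix_(s, a) d (s, a))).

Definition feature Phi (s : 'I_nS.+1) (a : 'I_nA.+1) : 'cV[R]_p :=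
  (row (mxvec_index s a) Phi)^T.

Definition qvalue Phi theta (s : 'I_nS.+1) (a : 'I_nA.+1) : R :=
  ((feature Phi s a)^T *m theta) 0 0.

Definition qmax Phi theta (s : 'I_nS.+1) : R :=
  \big[Num.max/qvalue Phi theta s ord0]_(a < nA.+1) qvalue Phi theta s a.

(* The fixed tie-breaking rule tie selects, in state s, one element of the set
   of maximizing actions. *)
Definition argmax_set Phi theta (s : 'I_nS.+1) : {set 'I_nA.+1} :=
  [set a | [forall b, qvalue Phi theta s b <= qvalue Phi theta s a]]%SET.

Definition tie_break_rule (tie : 'I_nS.+1 -> {set 'I_nA.+1} -> 'I_nA.+1) :=
  forall s (B : {set 'I_nA.+1}), B != finset.set0 -> tie s B \in B.

Definition greedy (tie : 'I_nS.+1 -> {set 'I_nA.+1} -> 'I_nA.+1) Phi theta :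
    policy R nS nA :=
  fun s => dirac_distr R (tie s (argmax_set Phi theta s)).

Definition T_mx M Phi pi d : 'M[R]_p :=
  discount M *: (Phi^T *m distr_mx d *m transition_mx M *m policy_mx pi *m Phi)
  - Phi^T *m distr_mx d *m Phi.

Definition F_vec M Phi theta pi d : 'cV[R]_p :=
  Phi^T *m distr_mx d *m reward_vec M + T_mx M Phi pi d *m theta.

Definition Feta_vec M Phi (eta : R) theta pi d : 'cV[R]_p :=
  F_vec M Phi theta pi d - eta *: theta.

Definition D_lin M Phi d (tie : 'I_nS.+1 -> {set 'I_nA.+1} -> 'I_nA.+1) :
    set 'cV[R]_p :=
  [set theta | differentiable
     (fun t : 'cV[R]_p => F_vec M Phi t (greedy tie Phi t) d) theta].

Definition qlearning_step M Phi (eta alpha : R)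
    (s : 'I_nS.+1) (a : 'I_nA.+1) (s' : 'I_nS.+1) theta : 'cV[R]_p :=
  theta + alpha *:
    ((reward M s a s' + discount M * qmax Phi theta s' - qvalue Phi theta s a)
       *: feature Phi s a - eta *: theta).

Fixpoint qlearning M Phi (eta : R) (alpha : nat -> R) (theta0 : 'cV[R]_p)
    (s : nat -> 'I_nS.+1) (a : nat -> 'I_nA.+1) (s' : nat -> 'I_nS.+1)
    (k : nat) : 'cV[R]_p :=
  if k is k'.+1 then
    qlearning_step M Phi eta (alpha k') (s k') (a k') (s' k')
      (qlearning M Phi eta alpha theta0 s a s' k')
  else theta0.

End Matrices.

(* row_dom A i is S_i(A); max_row_dom is its maximum over i, taken in \bar R so
   that suprema over theta are genuine ones (+oo for an unbounded set). *)
Definition row_dom (R : realType) (n : nat) (A : 'M[R]_n) (i : 'I_n) : R :=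
  A i i + \sum_(j < n | j != i) `|A i j|.

Definition max_row_dom (R : realType) (n : nat) (A : 'M[R]_n) : \bar R :=
  \big[maxe/-oo%E]_(i < n) (row_dom A i)%:E.

Section Sampling.
Variables (R : realType) (disp : measure_display) (Omega : measurableType disp).
Variable Pr : probability Omega R.

(* Measurability with respect to the discrete sigma-algebra on T. *)
Definition discrete_rv (T : Type) (X : Omega -> T) :=
  forall B : set T, measurable (X @^-1` B).

Definition mutually_independent (T : Type) (X : nat -> Omega -> T) :=
  forall (J : {fset nat}) (B : nat -> set T),
    Pr (\bigcap_(k in [set` J]) (X k @^-1` B k)) =
    (\prod_(k <- J) Pr (X k @^-1` B k))%E.

Record iid_transitions (nS nA : nat) (M : mdp R nS nA)
    (d : distr R ('I_nS.+1 * 'I_nA.+1)%type)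
    (s : nat -> Omega -> 'I_nS.+1) (a : nat -> Omega -> 'I_nA.+1)
    (s' : nat -> Omega -> 'I_nS.+1) : Prop := {
  transitions_rv : forall k, discrete_rv (fun w => (s k w, a k w, s' k w));
  transitions_indep :
    mutually_independent (fun k w => (s k w, a k w, s' k w));
  state_action_law : forall k x y,
    Pr [set w | s k w = x /\ a k w = y] = (d (x, y))%:E;
  next_state_law : forall k x y z,
    Pr [set w | [/\ s k w = x, a k w = y & s' k w = z]] =
    (Pr [set w | s k w = x /\ a k w = y] * (trans M x y z)%:E)%E }.

End Sampling.

(* Main.v *)
(* With the greedy value substituted, the mean increment f is piecewise affine,
   with Jacobian T(theta, pi_theta, d) - eta I off finitely many hyperplanes.
   Diagonal dominance there, integrated along segments, makes theta + h f(theta)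
   a sup-norm contraction for small h > 0; its fixed point is the unique zero
   theta* of f. Replacing the sup norm by an l^n norm, n even and large, loses
   only a factor p^(1/n), so V(theta) = sum_i (theta_i - theta*_i)^n is a smooth
   Lyapunov function: E V decreases by c alpha V up to an error
   O(alpha^2 (1 + V)). Hence E V(theta_k) -> 0, and Ville's maximal inequality
   for V(theta_k) + C sum_(j >= k) alpha_j^2 turns this into almost sure
   convergence. As n samples take finitely many values, only finite expectations
   occur. In the tabular case, S_i = -(1 - gamma) d(s, a) at every theta. *)

Require Import Defs.
From HB Require Import structures.
From mathcomp Require Import all_boot all_order all_algebra.
From mathcomp Require Import finmap.
From mathcomp Require Import all_classical all_reals all_analysis.
From mathcomp Require Import ring lra zify.

Set Implicit Arguments.
Unset Strict Implicit.
Unset Printing Implicit Defensive.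
Import Order.TTheory GRing.Theory Num.Theory.
Import numFieldNormedType.Exports.
Local Open Scope classical_set_scope.
Local Open Scope ring_scope.

(** * Expectations over finite sample histories *)

(** Points where actions with distinct features tie may escape [D_lin], and a whole segment may
    consist of such points. No integration takes place along such a segment: one endpoint is first
    moved to a [generic] point, which leaves finitely many bad parameters, and the estimate returns
    to the original endpoint because [mean_field] is Lipschitz everywhere.

    No conditional expectation is formed. The iterate is a function of a finite list of samples, the
    drift inequality holds at every state, and means are nested sums, tied to [Pr] by
    [prob_history]. The Euler step [h] is unrelated to the step sizes [alpha k]: it only converts
    the contraction into a negative first-order term of the drift, at a rate proportional to
    [1 / h]. *)

Fixpoint fexpect (R : realType) (T : finType) (q : T -> R) (n : nat)
    (f : seq T -> R) : R :=
  if n is m.+1 then \sum_x q x * fexpect q m (fun t => f (x :: t))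
  else f [::].

Lemma fexpect_le (R : realType) (T : finType) (q : T -> R) (n : nat)
    (f g : seq T -> R) : (forall x, 0 <= q x) ->
  (forall t, size t = n -> f t <= g t) -> fexpect q n f <= fexpect q n g.
Proof.
move=> q_ge0; elim: n f g => [|n IHn] f g lefg /=; first exact: lefg.
by apply: ler_sum => x _; apply: ler_wpM2l => //; apply: IHn => t tn;
  apply: lefg; rewrite /= tn.
Qed.

Lemma eq_fexpect (R : realType) (T : finType) (q : T -> R) (n : nat)
    (f g : seq T -> R) :
  (forall t, size t = n -> f t = g t) -> fexpect q n f = fexpect q n g.
Proof.
elim: n f g => [|n IHn] f g efg /=; first exact: efg.
apply: eq_bigr => x _; congr (_ * _); apply: IHn => t tn.
by apply: efg; rewrite /= tn.
Qed.

Lemma fexpect_affine (R : realType) (T : finType) (q : T -> R) (n : nat)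
    (a b : R) (f : seq T -> R) : \sum_x q x = 1 ->
  fexpect q n (fun t => a * f t + b) = a * fexpect q n f + b.
Proof.
move=> q1; elim: n f => [|n IHn] f //=.
under eq_bigr do rewrite IHn mulrDr mulrCA.
by rewrite big_split /= -mulr_sumr -mulr_suml q1 mul1r.
Qed.

Lemma fexpect_cat (R : realType) (T : finType) (q : T -> R) (m n : nat)
    (f : seq T -> R) :
  fexpect q (m + n) f =
  fexpect q m (fun s => fexpect q n (fun t => f (s ++ t))).
Proof. by elim: m f => [|m IHm] f //=; apply: eq_bigr => x _; rewrite IHm. Qed.

Section history.
Variables (R : realType) (disp : measure_display) (Omega : measurableType disp).
Variables (Pr : probability Omega R) (T : finType) (X : nat -> Omega -> T).
Hypothesis X_rv : forall k, discrete_rv (X k).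

(** The induction runs over all predicates at once: fixing the last sample [x] leaves the shorter
    history with the predicate [P (rcons t x)]. *)
Lemma measurable_history (n : nat) (P : seq T -> Prop) :
  measurable [set w | P (mkseq (X ^~ w) n)].
Proof.
elim: n P => [|n IHn] P.
  have [p|np] := pselect (P [::]).
    by rewrite (_ : [set w | _] = setT) //; apply/seteqP; split.
  by rewrite (_ : [set w | _] = set0) //; apply/seteqP; split.
rewrite (_ : [set w | _] = \bigcup_(x in [set: T])
    ((X n @^-1` [set x]) `&` [set w | P (rcons (mkseq (X ^~ w) n) x)])).
  apply: fin_bigcup_measurable; first exact: finite_finset.
  move=> x _; apply: measurableI; first exact: X_rv.
  exact: (IHn (fun t => P (rcons t x))).
apply/seteqP; split => w /=; rewrite mkseqS.
  by move=> Pw; exists (X n w).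
by move=> [x _ [/= -> ]].
Qed.

Variable q : T -> R.
Hypothesis X_ind : mutually_independent Pr X.
Hypothesis X_law : forall k x, Pr (X k @^-1` [set x]) = (q x)%:E.

Lemma prob_cylinder (x0 : T) (t : seq T) :
  Pr [set w | mkseq (X ^~ w) (size t) = t] =
  (\prod_(i < size t) q (nth x0 t i))%:E.
Proof.
have -> : [set w | mkseq (X ^~ w) (size t) = t] =
  \bigcap_(k in [set` [fset k in iota 0 (size t)]%fset])
     (X k @^-1` [set nth x0 t k]).
  apply/seteqP; split => [w /= <- k /=|w /= wt].
    by rewrite !inE mem_iota /= add0n size_mkseq => kt; rewrite nth_mkseq.
  apply: (@eq_from_nth _ x0); rewrite size_mkseq // => k kt.
  by rewrite nth_mkseq //; apply: wt; rewrite /= !inE mem_iota.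
rewrite X_ind (perm_big (iota 0 (size t))) /=; last first.
  by apply: uniq_perm; rewrite ?iota_uniq ?fset_uniq // => k; rewrite !inE.
under eq_bigr do rewrite X_law.
rewrite -[X in iota 0 X]subn0 -/(index_iota _ _) big_mkord.
by elim/big_rec2 : _ => // i y1 y2 _ ->.
Qed.

Lemma prob_history_prefix (x0 : T) (n : nat) (t : seq T) (P : seq T -> bool) :
  Pr [set w | mkseq (X ^~ w) (size t) = t /\
              P (mkseq (X ^~ w) (size t + n))] =
  ((\prod_(i < size t) q (nth x0 t i)) *
   fexpect q n (fun u => (P (t ++ u))%:R))%:E.
Proof.
elim: n t => [|n IHn] t /=.
  rewrite cats0 addn0.
  case Pt : (P t); last first.
    rewrite mulr0 (_ : [set w | _] = set0) ?measure0 //.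
    by apply/seteqP; split=> // w /= [->]; rewrite Pt.
  rewrite mulr1 -prob_cylinder; congr (Pr _).
  by apply/seteqP; split => w /=; [case | move=> wt; rewrite wt Pt].
rewrite (_ : [set w | _] = \bigcup_(x in [set: T])
    [set w | mkseq (X ^~ w) (size (rcons t x)) = rcons t x /\
             P (mkseq (X ^~ w) (size (rcons t x) + n))]); last first.
  apply/seteqP; split => [w /= [wt Pw]|w /= [x _ []]].
    exists (X (size t) w) => //=.
    by rewrite size_rcons addSnnS mkseqS wt.
  by rewrite size_rcons addSnnS mkseqS => /rcons_inj[-> _].
rewrite measure_fin_bigcup //; last 3 first.
- exact: finite_finset.
- move=> x y _ _ [w /= [[wx _] [wy _]]].
  by move: wx wy; rewrite !size_rcons => -> /rcons_inj[].
- move=> x _; set m := size _.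
  rewrite (_ : [set w | _] =
     [set w | (fun u => take m u = rcons t x /\ P u) (mkseq (X ^~ w) (m + n))]).
    exact: (measurable_history (m + n)
              (fun u => take m u = rcons t x /\ P u)).
  apply/seteqP; split => w /=; rewrite /mkseq -map_take take_iota;
    by rewrite (minn_idPl (leq_addr n m)).
rewrite (_ : [set: T] = [set` index_enum T]); last first.
  by apply/seteqP; split => x //= _; rewrite mem_index_enum.
rewrite -fsbig_seq ?index_enum_uniq // mulr_sumr -sumEFin.
apply: eq_bigr => x _.
rewrite [LHS](IHn (rcons t x)); congr (_%:E).
rewrite size_rcons big_ord_recr /= nth_rcons ltnn eqxx -mulrA; congr (_ * _).
  by apply: eq_bigr => i _; rewrite nth_rcons ltn_ord.
by congr (_ * _); apply: eq_fexpect => u _; rewrite cat_rcons.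
Qed.

Lemma prob_history (n : nat) (P : seq T -> bool) :
  Pr [set w | P (mkseq (X ^~ w) n)] =
  (fexpect q n (fun u => (P u)%:R))%:E.
Proof.
(* Total mass one forces [Omega] to be nonempty, which supplies the default element of [T]. *)
have [w] : exists w : Omega, True.
  apply: contrapT => noOmega; have := @probability_setT _ _ _ Pr.
  rewrite (_ : setT = set0) ?measure0.
    by move/esym/eqP; rewrite onee_eq0.
  by apply/seteqP; split => // w _; apply: noOmega; exists w.
move=> _; have := prob_history_prefix (X 0 w) n [::] P.
rewrite /= big_ord0 mul1r => <-; congr (Pr _).
by apply/seteqP; split => v //= -[].
Qed.
End history.

(** * Almost sure convergence from a drift condition *)

Fixpoint run (S T : Type) (step : nat -> T -> S -> S) (k : nat) (y : S)
    (t : seq T) : S :=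
  if t is x :: t' then run step k.+1 (step k x y) t' else y.

Lemma run_cat (S T : Type) (step : nat -> T -> S -> S) (k : nat) (y : S)
    (t u : seq T) :
  run step k y (t ++ u) = run step (k + size t) (run step k y t) u.
Proof.
elim: t k y => [|x t IHt] k y /=; first by rewrite addn0.
by rewrite IHt addSnnS.
Qed.

(** A boolean function of the sample list, so that [prob_history] turns the probability of reaching
    level [l] within a finite horizon into an [fexpect]. *)
Fixpoint hits (R : realType) (S T : Type) (step : nat -> T -> S -> S)
    (W : nat -> S -> R) (l : R) (k : nat) (y : S) (t : seq T) : bool :=
  (l <= W k y) ||
  (if t is x :: t' then hits step W l k.+1 (step k x y) t' else false).

Lemma hits_run (R : realType) (S T : Type) (step : nat -> T -> S -> S)
    (W : nat -> S -> R) (l : R) (k : nat) (y : S) (t u : seq T) :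
  l <= W (k + size t)%N (run step k y t) -> hits step W l k y (t ++ u).
Proof.
elim: t k y => [|x t IHt] k y /=.
  by rewrite addn0; case: u => /= [|a u] ->.
by rewrite -addSnnS => /IHt ->; rewrite orbT.
Qed.

(* Ville's maximal inequality over a finite horizon: going back one step in
   time, the hitting probability inherits the supermartingale bound. *)
Lemma fexpect_hits_le (R : realType) (S : Type) (T : finType) (q : T -> R)
    (step : nat -> T -> S -> S) (W : nat -> S -> R) (l : R) (K n k : nat)
    (y : S) :
  (forall x, 0 <= q x) -> \sum_x q x = 1 -> 0 < l ->
  (forall k y, 0 <= W k y) ->
  (forall k y, (K <= k)%N -> \sum_x q x * W k.+1 (step k x y) <= W k y) ->
  (K <= k)%N ->
  fexpect q n (fun t => (hits step W l k y t)%:R) <= W k y / l.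
Proof.
move=> q_ge0 q1 l_gt0 W_ge0 superW.
elim: n k y => [|n IHn] k y Kk /=; have [lW|Wl] := boolP (l <= W k y).
- by rewrite ler_pdivlMr ?mul1r.
- by rewrite divr_ge0 // ltW.
- rewrite ler_pdivlMr // (le_trans _ lW) // ler_piMl ?(ltW l_gt0) // -[leRHS]q1.
  apply: ler_sum => x _; apply: ler_piMr => //.
  under eq_fexpect do rewrite orTb.
  rewrite (_ : (fun _ => _) = fun t => 0 * 0 + 1); first last.
    by apply/funext => ?; rewrite mul0r add0r.
  by rewrite (@fexpect_affine _ _ _ _ 0 1 (fun=> 0)) // mul0r add0r.
- rewrite (le_trans _ (ler_wpM2r _ (superW k y Kk))) ?invr_ge0 ?(ltW l_gt0) //.
  rewrite mulr_suml; apply: ler_sum => x _; rewrite -mulrA.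
  by apply: ler_wpM2l => //; apply: IHn; rewrite ltnW.
Qed.

(** The tail absorbs the noise: [v k + C * tail k] is nonincreasing from [K] on. Were [v] to stay
    above [e / 2], this quantity would lose at least [c * alpha k * e / 2] at each step and become
    negative, the steps having infinite sum. Hence it falls below [e] once, and stays there. *)
Lemma robbins_monro_cvg0 (R : realType) (alpha tail v : nat -> R) (c C : R)
    (K : nat) : 0 < c -> 0 <= C -> (forall k, 0 <= v k) ->
  (forall k, tail k = alpha k ^+ 2 + tail k.+1) -> (forall k, 0 <= tail k) ->
  (forall k, 0 <= alpha k) ->
  (forall e : R, 0 < e -> exists N, forall k, (N <= k)%N -> tail k < e) ->
  (forall m (A : R), exists n, A <= \sum_(m <= k < n) alpha k) ->
  (forall k, (K <= k)%N ->
     v k.+1 <= (1 - c * alpha k) * v k + C * alpha k ^+ 2) ->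
  forall e : R, 0 < e -> exists N, forall k, (N <= k)%N -> v k + C * tail k < e.
Proof.
move=> c_gt0 C_ge0 v_ge0 tailS tail_ge0 alpha_ge0 tail0 alphaoo vS e e_gt0.
pose w k := v k + C * tail k.
have w_ge0 k : 0 <= w k by rewrite addr_ge0 // mulr_ge0.
have wS k : (K <= k)%N -> w k.+1 <= w k - c * alpha k * v k.
  by move=> /vS; rewrite /w (tailS k); lra.
have wS' k : (K <= k)%N -> w k.+1 <= w k.
  move=> Kk; apply: (le_trans (wS _ Kk)); rewrite gerBl mulr_ge0 //.
  by rewrite mulr_ge0 // ltW.
have w_le k n : (K <= k <= n)%N -> w n <= w k.
  move=> /andP[Kk /subnKC <-].
  elim: (n - k)%N => [|j IHj]; first by rewrite addn0.
  by rewrite addnS (le_trans (wS' _ _)) // (leq_trans Kk) // leq_addr.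
have [N1 tailN] : exists N, forall k, (N <= k)%N -> C * tail k < e / 2.
  have [N HN] := tail0 (e / 2 / (C + 1)) ltac:(by rewrite !divr_gt0 //; lra).
  exists N => k /HN; rewrite ltr_pdivlMr; last by lra.
  by have := tail_ge0 k; nra.
pose K1 := maxn K N1.
have [[k [K1k vk]]|noV] := pselect (exists k, (K1 <= k)%N /\ v k < e / 2).
  exists k => n kn; rewrite geq_max in K1k; case/andP: K1k => Kk N1k.
  have := w_le k n; rewrite Kk kn => /(_ isT).
  by have := tailN _ N1k; rewrite /w; lra.
have vK1 k : (K1 <= k)%N -> e / 2 <= v k.
  by move=> K1k; rewrite leNgt; apply/negP => vk; apply: noV; exists k.
have [n alphan] := alphaoo K1 ((w K1 + 1) / (c * (e / 2))).
have ce_gt0 : 0 < c * (e / 2) by rewrite mulr_gt0 // divr_gt0.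
rewrite ler_pdivrMr // in alphan.
have wK1 j : w (K1 + j)%N <=
    w K1 - (\sum_(K1 <= k < K1 + j) alpha k) * (c * (e / 2)).
  elim: j => [|j IHj]; first by rewrite addn0 big_geq // mul0r subr0.
  rewrite addnS big_nat_recr ?leq_addr //=.
  have KK : (K <= K1 + j)%N by rewrite (leq_trans (leq_maxl K N1)) // leq_addr.
  have := wS _ KK; have := vK1 (K1 + j)%N (leq_addr _ _).
  have := mulr_ge0 (ltW c_gt0) (alpha_ge0 (K1 + j)%N); nra.
have := wK1 (n - K1)%N; have := w_ge0 (K1 + (n - K1))%N.
have [K1n|nK1] := leqP K1 n; first by rewrite subnKC //; lra.
(* With an empty sum the choice of [n] already reads [w K1 + 1 <= 0]. *)
rewrite big_geq ?mul0r in alphan; last exact: ltnW.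
by have := w_ge0 K1; lra.
Qed.

Lemma hits_cat (R : realType) (S T : Type) (step : nat -> T -> S -> S)
    (W : nat -> S -> R) (l : R) (k : nat) (y : S) (t u : seq T) :
  hits step W l k y t -> hits step W l k y (t ++ u).
Proof.
elim: t k y => [|x t IHt] k y /=.
  by rewrite orbF; case: u => [|a u] /= ->.
by case/orP => [->|/IHt ->] //; rewrite orbT.
Qed.

(** Exceeding [l] after time [k] has probability at most the mean of [W k] over [l], which tends to
    zero with [k]; so exceeding [l] after every [k] is a null event. The levels [1 / (j + 1)] give
    convergence outside a countable union of null sets. *)
Lemma ae_run_cvg0 (R : realType) (disp : measure_display)
    (Omega : measurableType disp) (Pr : probability Omega R) (T : finType)
    (X : nat -> Omega -> T) (q : T -> R) (S : Type)
    (step : nat -> T -> S -> S) (y0 : S) (V : S -> R)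
    (alpha tail : nat -> R) (c C : R) (K : nat) :
  (forall k, discrete_rv (X k)) -> mutually_independent Pr X ->
  (forall k x, Pr (X k @^-1` [set x]) = (q x)%:E) -> \sum_x q x = 1 ->
  0 < c -> 0 <= C -> (forall y, 0 <= V y) ->
  (forall k, tail k = alpha k ^+ 2 + tail k.+1) -> (forall k, 0 <= tail k) ->
  (forall k, 0 <= alpha k) ->
  (forall e : R, 0 < e -> exists N, forall k, (N <= k)%N -> tail k < e) ->
  (forall m (A : R), exists n, A <= \sum_(m <= k < n) alpha k) ->
  (forall k y, (K <= k)%N ->
     \sum_x q x * V (step k x y) <=
       (1 - c * alpha k) * V y + C * alpha k ^+ 2) ->
  {ae Pr, forall w,
     V (run step 0 y0 (mkseq (X ^~ w) n)) @[n --> \oo] --> (0 : R)}.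
Proof.
move=> X_rv X_ind X_law q1 c_gt0 C_ge0 V_ge0 tailS tail_ge0 alpha_ge0 tail0
  alphaoo drift.
have q_ge0 x : 0 <= q x by rewrite -lee_fin -(X_law 0%N) measure_ge0.
pose v k := fexpect q k (fun t => V (run step 0 y0 t)).
pose W k y := V y + C * tail k.
have W_ge0 k y : 0 <= W k y by rewrite addr_ge0 // mulr_ge0.
have superW k y : (K <= k)%N -> \sum_x q x * W k.+1 (step k x y) <= W k y.
  move=> /(drift _ y) le; under eq_bigr do rewrite mulrDr.
  rewrite big_split /= -mulr_suml q1 mul1r /W (tailS k).
  have : 0 <= c * alpha k * V y by rewrite !mulr_ge0 // ltW.
  by move: le; lra.
have v_ge0 k : 0 <= v k.
  rewrite (_ : 0 = fexpect q k (fun=> 0 * 0 + 0)); last first.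
    by rewrite (@fexpect_affine _ _ _ _ 0 0 (fun=> 0)) // mul0r addr0.
  by apply: fexpect_le => // t _; rewrite mul0r addr0.
have vS k : (K <= k)%N ->
    v k.+1 <= (1 - c * alpha k) * v k + C * alpha k ^+ 2.
  move=> Kk; rewrite -fexpect_affine // /v -addn1 fexpect_cat.
  apply: fexpect_le => // t tk /=.
  by under eq_bigr do rewrite run_cat /= tk; exact: drift.
have vW0 := robbins_monro_cvg0 c_gt0 C_ge0 v_ge0 tailS tail_ge0 alpha_ge0
  tail0 alphaoo vS.
(* The first [k] samples only build the starting state; the level is tested from time [k] on. *)
pose hit (l : R) k (u : seq T) :=
  hits step W l k (run step 0 y0 (take k u)) (drop k u).
pose B l k n := [set w | hit l k (mkseq (X ^~ w) (k + n))].
have mB l k n : measurable (B l k n).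
  exact: (measurable_history X_rv _ (hit l k)).
have mUB l k : measurable (\bigcup_n B l k n) by exact: bigcupT_measurable.
have PB l k n : 0 < l -> (K <= k)%N ->
    (Pr (B l k n) <= ((v k + C * tail k) / l)%:E)%E.
  move=> l_gt0 Kk; rewrite (prob_history X_rv X_ind X_law) lee_fin fexpect_cat.
  rewrite mulrDl mulrC -fexpect_affine //.
  apply: fexpect_le => // t tk.
  under eq_fexpect do rewrite /hit take_size_cat // drop_size_cat //.
  rewrite mulrC -mulrDl.
  exact: (fexpect_hits_le n _ q_ge0 q1 l_gt0 W_ge0 superW Kk).
have PUB l k : 0 < l -> (K <= k)%N ->
    (Pr (\bigcup_n B l k n) <= ((v k + C * tail k) / l)%:E)%E.
  (* Continuity from below extends the bound from finite horizons to the infinite one. *)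
  move=> l_gt0 Kk; have ndB : nondecreasing_seq (B l k).
    apply/nondecreasing_seqP => n; apply/subsetPset => w; rewrite /B /= /hit.
    rewrite addnS mkseqS; set u := mkseq _ _.
    have ku : (k <= size u)%N by rewrite size_mkseq leq_addr.
    rewrite -cats1 takel_cat //.
    move/(@hits_cat _ _ _ _ _ _ _ _ _ [:: X (k + n)%N w]).
    rewrite -[in drop k (_ ++ _)](cat_take_drop k u) -catA.
    by rewrite drop_size_cat ?size_takel.
  have := @nondecreasing_cvg_mu _ _ _ Pr _ (mB l k) (mUB l k) ndB.
  move=> /cvg_lim <- //; apply: lime_le.
    apply: ereal_nondecreasing_is_cvgn; move=> m n mn /=.
    by apply: le_measure; rewrite ?inE //; exact/subsetPset/ndB.
  by apply: nearW => n; exact: PB.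
have negB l : 0 < l -> Pr.-negligible (\bigcap_k \bigcup_n B l k n).
  move=> l_gt0; exists (\bigcap_k \bigcup_n B l k n); split => //.
    exact: bigcapT_measurable.
  apply/eqP; rewrite eq_le measure_ge0 andbT.
  apply/lee_addgt0Pr => e e_gt0; rewrite add0e.
  have [N HN] := vW0 (e * l) (mulr_gt0 e_gt0 l_gt0).
  pose k := maxn K N.
  apply: (@le_trans _ _ (Pr (\bigcup_n B l k n))).
    apply: le_measure; rewrite ?inE //; first exact: bigcapT_measurable.
    exact: bigcap_inf.
  apply: (le_trans (PUB _ k l_gt0 (leq_maxl _ _))).
  by rewrite lee_fin ler_pdivrMr // ltW // HN // leq_maxr.
have := negligible_bigcup (fun j => negB j.+1%:R^-1 ltac:(by rewrite invr_gt0)).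
apply: negligibleS => w /= ncvg; apply: contrapT => nB; apply: ncvg.
apply/cvgrPdist_lt => e e_gt0.
have [j je] : exists j, j.+1%:R^-1 < e.
  have /ltr_add_invr[j] := e_gt0; rewrite add0r => je; by exists j.
have [k Bk] : exists k, ~ (\bigcup_n B j.+1%:R^-1 k n) w.
  apply: contrapT => noB; apply: nB; exists j => // k _.
  by apply: contrapT => nBk; apply: noB; exists k.
exists k => // n /= kn; rewrite sub0r normrN ger0_norm //.
apply: le_lt_trans je; rewrite leNgt; apply/negP => lV; apply: Bk.
exists (n - k)%N => //; rewrite /B /= /hit subnKC //.
set u := mkseq _ _; have un : size u = n by rewrite size_mkseq.
rewrite -[drop _ _]cats0; apply: hits_run; rewrite size_drop un subnKC //.
have su : size (take k u) = k by rewrite size_takel ?un.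
have := run_cat step 0 y0 (take k u) (drop k u).
rewrite cat_take_drop su add0n => <-.
by rewrite (le_trans (ltW lV)) // lerDl mulr_ge0.
Qed.

(** * The Lyapunov function *)

(** The remainders satisfy [r_(m+1) = (m+1) a^2 x^m g^2 + (x + a g) r_m]. As [|x + a g| <= 2 N] and
    [m + 1 <= 2 * 4^m], each of the two terms is at most half of the bound with factor [4^(m+1)]. *)
Lemma expr_second_order (R : realType) (m : nat) (x g a N : R) :
  0 <= a <= 1 -> `|x| <= N -> `|g| <= N ->
  `|(x + a * g) ^+ m.+1 - (x ^+ m.+1 + m.+1%:R * a * x ^+ m * g)| <=
    4 ^+ m * a ^+ 2 * N ^+ m.+1.
Proof.
move=> /andP[a_ge0 a_le1] xN gN.
have N_ge0 : 0 <= N := le_trans (normr_ge0 x) xN.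
elim: m => [|m IHm].
  rewrite !expr1 !expr0 !mul1r mulr1 subrr normr0.
  by rewrite mulr_ge0 // exprn_ge0.
set r := _ - _ in IHm.
have -> : (x + a * g) ^+ m.+2 - (x ^+ m.+2 + m.+2%:R * a * x ^+ m.+1 * g) =
    m.+1%:R * (a ^+ 2) * (x ^+ m * g ^+ 2) + (x + a * g) * r.
  by rewrite /r !exprS -!natr1; ring.
have xg : `|x + a * g| <= 2 * N.
  rewrite (le_trans (ler_normD _ _)) // normrM (ger0_norm a_ge0).
  have : a * `|g| <= 1 * N by apply: ler_pM.
  by move: xN; lra.
have xm : `|x ^+ m * g ^+ 2| <= N ^+ m.+2.
  rewrite normrM !normrX -[m.+2]addn2 exprD; apply: ler_pM;
    by rewrite ?exprn_ge0 // lerXn2r ?nnegrE.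
have := ler_pM (normr_ge0 _) (normr_ge0 _) xg IHm.
rewrite -normrM; set s := _ * r => sN.
rewrite (le_trans (ler_normD _ _)) // normrM ger0_norm; last first.
  by rewrite mulr_ge0 // exprn_ge0.
have m4 : m.+1%:R <= 2 * 4 ^+ m :> R.
  rewrite -natrX -natrM ler_nat; elim: m {IHm r xm sN s} => // m IHm.
  by rewrite expnS; lia.
have N2 : 0 <= N ^+ m.+2 by rewrite exprn_ge0.
have a2 : 0 <= a ^+ 2 by rewrite exprn_ge0.
have h1 : m.+1%:R * a ^+ 2 * `|x ^+ m * g ^+ 2| <=
    (2 * 4 ^+ m) * a ^+ 2 * N ^+ m.+2.
  apply: ler_pM => //; first by rewrite mulr_ge0.
  exact: ler_wpM2r.
apply: le_trans (lerD h1 sN) _.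
by rewrite !exprS le_eqVlt; apply/orP; left; apply/eqP; ring.
Qed.

Lemma exists_expr_lt (R : realType) (x e : R) : 0 <= x < 1 -> 0 < e ->
  exists n, forall k, (n <= k)%N -> x ^+ k < e.
Proof.
move=> /andP[x_ge0 x_lt1] e_gt0.
have := @cvg_expr R x; rewrite ger0_norm // => /(_ x_lt1)/cvgrPdist_lt.
move=> /(_ _ e_gt0)[n _ Hn]; exists n => k nk; have /= := Hn k nk.
by rewrite sub0r normrN ger0_norm // exprn_ge0.
Qed.

Lemma max_norm_attained (R : realType) (p : nat) (x : 'I_p -> R) :
  exists N, [/\ 0 <= N, forall i, `|x i| <= N &
    forall n, N ^+ n.+1 <= \sum_i `|x i| ^+ n.+1].
Proof.
exists (\big[Num.max/0]_i `|x i|); split; first exact: bigmax_ge_id.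
  by move=> i; apply: le_bigmax.
move=> n; have S_ge0 (P : pred 'I_p) : 0 <= \sum_(i | P i) `|x i| ^+ n.+1.
  by apply: sumr_ge0 => i _; rewrite exprn_ge0.
apply: (big_ind (fun y => y ^+ n.+1 <= \sum_i `|x i| ^+ n.+1)) => [|y z|i _].
- by rewrite expr0n.
- by move=> yS zS; rewrite maxEle; case: ifP.
- by rewrite (bigD1 i) //= lerDl.
Qed.

(* In the norm of exponent m + 1, with m large, a sup-norm contraction is a
   strict contraction up to the factor p^(1/(m+1)), which tends to 1. Small
   coordinates, below r N, are dominated by the maximal one. *)
Lemma contraction_power_drift (R : realType) (p : nat) (rho : R) :
  0 <= rho < 1 ->
  exists (m : nat) (c : R), [/\ odd m, 0 < c & forall x u : 'I_p -> R,
    (forall N, (forall i, `|x i| <= N) -> forall i, `|u i| <= rho * N) ->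
    \sum_i x i ^+ m * (u i - x i) <= - c * \sum_i x i ^+ m.+1].
Proof.
move=> /andP[rho_ge0 rho_lt1].
pose r := (1 + rho) / 2.
have r_gt0 : 0 < r by rewrite /r; lra.
have r_lt1 : r < 1 by rewrite /r; lra.
have rho_r : rho < r by rewrite /r; lra.
(* A coordinate with [|x i| > r N] has [rho * N <= rho / r * |x i|], a gain of
   [1 - rho / r = 2 * c]. One [c] is kept as the rate; the other pays for the small coordinates,
   once [m] is so large that [p * r ^ m.+1 <= c]. *)
pose c := (1 - rho / r) / 2.
have c_gt0 : 0 < c by rewrite /c divr_gt0 // subr_gt0 ltr_pdivrMr // mul1r.
have [n Hn] : exists n, forall k, (n <= k)%N -> r ^+ k < c / (p%:R + 1).
  apply: exists_expr_lt; first by rewrite ltW.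
  by rewrite divr_gt0 // ltr_wpDl.
exists n.*2.+1, c; split => //; first by rewrite /= odd_double.
set m := n.*2.+1 => x u xu.
have evenE (y : R) : y ^+ m.+1 = `|y| ^+ m.+1.
  by rewrite -normrX ger0_norm // exprn_even_ge0 //= odd_double.
have [N [N_ge0 xN NS]] := max_norm_attained x.
have uN := xu N xN.
have pr : p%:R * r ^+ m.+1 <= c.
  have := Hn m.+1 ltac:(rewrite /m; lia).
  rewrite ltr_pdivlMr ?ltr_wpDl // => /ltW; apply: le_trans.
  by rewrite mulrC ler_wpM2l ?exprn_ge0 ?(ltW r_gt0) // lerDl.
have term i : x i ^+ m * (u i - x i) <=
    (rho / r - 1) * `|x i| ^+ m.+1 + r ^+ m.+1 * N ^+ m.+1.
  rewrite mulrBr -exprSr [x i ^+ m.+1]evenE mulrBl mul1r addrAC lerD2r.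
  have le1 : x i ^+ m * u i <= `|x i| ^+ m * (rho * N).
    by rewrite (le_trans (ler_norm _)) // normrM normrX ler_wpM2l ?exprn_ge0.
  apply: (le_trans le1); have [xr|rx] := leP (`|x i|) (r * N).
    apply: (@le_trans _ _ ((r * N) ^+ m * (r * N))).
      apply: ler_pM; rewrite ?exprn_ge0 ?mulr_ge0 //.
        by rewrite lerXn2r // nnegrE mulr_ge0 // ltW.
      by rewrite ler_wpM2r // ltW.
    rewrite -exprSr exprMn lerDr mulr_ge0 ?exprn_ge0 //.
    by rewrite divr_ge0 // ltW.
  rewrite exprSr mulrCA -mulrA.
  apply: (@le_trans _ _ (rho * (r^-1 * (`|x i| ^+ m * `|x i|)))).
    apply: ler_wpM2l => //; rewrite mulrCA.
    apply: ler_wpM2l; first by rewrite exprn_ge0.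
    by rewrite mulrC ler_pdivlMr // mulrC ltW.
  by rewrite lerDl mulr_ge0 ?exprn_ge0 // ltW.
apply: (le_trans (ler_sum _ (fun i _ => term i))).
rewrite big_split /= -mulr_sumr sumr_const card_ord -mulr_natl mulrA.
under [in leRHS]eq_bigr do rewrite evenE.
set S := \sum_i _.
have S_ge0 : 0 <= S by apply: sumr_ge0 => i _; rewrite exprn_ge0.
have : p%:R * r ^+ m.+1 * N ^+ m.+1 <= c * S.
  apply: ler_pM; [| exact: exprn_ge0 | exact: pr | exact: (NS m)].
  by rewrite mulr_ge0 // exprn_ge0 // ltW.
have -> : rho / r - 1 = - (2 * c) by rewrite /c; field; rewrite gt_eqF.
by lra.
Qed.

Lemma expr1D_le (R : realType) (n : nat) (N : R) : 0 <= N ->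
  (1 + N) ^+ n <= 2 ^+ n * (1 + N ^+ n).
Proof.
move=> N_ge0; have [N1|N1] := leP N 1.
  apply: (@le_trans _ _ (2 ^+ n)).
    by rewrite lerXn2r ?nnegrE ?addr_ge0 //; lra.
  by rewrite ler_peMr ?exprn_ge0 // lerDl exprn_ge0.
apply: (@le_trans _ _ ((2 * N) ^+ n)).
  by rewrite lerXn2r ?nnegrE ?addr_ge0 ?mulr_ge0 //; lra.
by rewrite exprMn ler_wpM2l ?exprn_ge0 // lerDr.
Qed.

(** With [x = y - z] and [f] the mean increment, [contraction_power_drift] applied to [u = x + h f]
    bounds the first-order term [sum x^m f] by [- (c0 / h) V]. Linear growth of the increments keeps
    the second-order remainder below a constant times [a^2 (1 + V)]. *)
Lemma lyapunov_drift (R : realType) (T : finType) (q : T -> R) (p : nat)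
    (g : T -> 'cV[R]_p -> 'cV[R]_p) (z : 'cV[R]_p) (h rho L : R) :
  (forall x, 0 <= q x) -> \sum_x q x = 1 -> 0 < h -> 0 <= rho < 1 -> 0 <= L ->
  (forall x y N, (forall i, `|(y - z) i 0| <= N) ->
     forall i, `|g x y i 0| <= L * (1 + N)) ->
  (forall y N, (forall i, `|(y - z) i 0| <= N) -> forall i,
     `|(y - z) i 0 + h * (\sum_x q x * g x y i 0)| <= rho * N) ->
  exists (m : nat) (c C : R), [/\ odd m, 0 < c, 0 <= C & forall y a,
    0 <= a <= 1 ->
    \sum_x q x * (\sum_i ((y + a *: g x y - z) i 0) ^+ m.+1) <=
      (1 - c * a + C * a ^+ 2) * (\sum_i ((y - z) i 0) ^+ m.+1) + C * a ^+ 2].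
Proof.
move=> q_ge0 q1 h_gt0 rho01 L_ge0 growth contr.
have [m [c0 [om c0_gt0 drift]]] := contraction_power_drift p rho01.
pose D := (2 * (L + 1)) ^+ m.+1.
have D_ge0 : 0 <= D by rewrite exprn_ge0 // mulr_ge0 // addr_ge0.
exists m, (m.+1%:R * c0 / h), (p%:R * (4 ^+ m * D)); split => //.
- by rewrite divr_gt0 // mulr_gt0.
- by rewrite !mulr_ge0 // exprn_ge0.
move=> y a a01; have /andP[a_ge0 a_le1] := a01.
pose x i := (y - z) i 0.
pose f i := \sum_t q t * g t y i 0.
have [N [N_ge0 xN NS]] := max_norm_attained x.
set V := \sum_i (y - z) i 0 ^+ m.+1.
have VE : V = \sum_i `|x i| ^+ m.+1.
  apply: eq_bigr => i _.
  by rewrite -normrX ger0_norm // exprn_even_ge0 //= om.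
have xf : \sum_i x i ^+ m * f i <= - (c0 / h) * V.
  have := drift x (fun i => x i + h * f i) (contr y).
  under eq_bigr do rewrite addrAC subrr add0r mulrCA.
  rewrite -mulr_sumr => le; rewrite -(ler_pM2l h_gt0).
  suff -> : h * (- (c0 / h) * V) = - c0 * V by [].
  by field; rewrite gt_eqF.
pose Q := (L + 1) * (1 + N).
have Q_ge0 : 0 <= Q by rewrite mulr_ge0 // addr_ge0.
have QD : Q ^+ m.+1 <= D * (1 + V).
  rewrite /Q /D !exprMn [2 ^+ _ * _]mulrC -mulrA.
  apply: ler_wpM2l; first by rewrite exprn_ge0 // addr_ge0.
  apply: le_trans (expr1D_le _ N_ge0) _.
  by rewrite ler_wpM2l ?exprn_ge0 // lerD2l VE NS.
have term t i : ((y + a *: g t y - z) i 0) ^+ m.+1 <=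
    x i ^+ m.+1 + m.+1%:R * a * x i ^+ m * g t y i 0 +
    4 ^+ m * a ^+ 2 * Q ^+ m.+1.
  have -> : (y + a *: g t y - z) i 0 = x i + a * g t y i 0.
    by rewrite /x !mxE; ring.
  rewrite -lerBlDl; apply: le_trans (ler_norm _) _.
  apply: expr_second_order => //.
    by rewrite (le_trans (xN i)) // /Q mulrDl mul1r; nra.
  by rewrite (le_trans (growth t y N xN i)) // /Q; nra.
have sum_term t : \sum_i ((y + a *: g t y - z) i 0) ^+ m.+1 <=
    V + m.+1%:R * a * (\sum_i x i ^+ m * g t y i 0) +
    p%:R * (4 ^+ m * a ^+ 2 * Q ^+ m.+1).
  apply: (le_trans (ler_sum _ (fun i _ => term t i))).
  rewrite !big_split /= sumr_const card_ord -[_ *+ p]mulr_natl mulr_sumr.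
  by under [X in _ <= _ + X + _]eq_bigr do rewrite mulrA.
apply: (@le_trans _ _ (\sum_t q t *
    (V + m.+1%:R * a * (\sum_i x i ^+ m * g t y i 0) +
     p%:R * (4 ^+ m * a ^+ 2 * Q ^+ m.+1)))).
  by apply: ler_sum => t _; apply: ler_wpM2l.
have -> : \sum_t q t *
    (V + m.+1%:R * a * (\sum_i x i ^+ m * g t y i 0) +
     p%:R * (4 ^+ m * a ^+ 2 * Q ^+ m.+1)) =
  V + m.+1%:R * a * (\sum_i x i ^+ m * f i) +
    p%:R * (4 ^+ m * a ^+ 2 * Q ^+ m.+1).
  under eq_bigr do rewrite !mulrDr mulrCA.
  rewrite !big_split /= -!mulr_suml q1 !mul1r -mulr_sumr.
  congr (_ + _ * _ + _).
  under eq_bigr => t _ do rewrite mulr_sumr.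
  under [in LHS]eq_bigr => t _ do rewrite mulr_sumr.
  rewrite exchange_big /=; apply: eq_bigr => i _; apply: eq_bigr => t _.
  by rewrite mulrCA.
have h1 : m.+1%:R * a * (\sum_i x i ^+ m * f i) <=
    m.+1%:R * a * (- (c0 / h) * V).
  by rewrite ler_wpM2l // mulr_ge0.
have h2 : p%:R * (4 ^+ m * a ^+ 2 * Q ^+ m.+1) <=
    p%:R * (4 ^+ m * a ^+ 2 * (D * (1 + V))).
  by rewrite !ler_wpM2l // mulr_ge0 // exprn_ge0.
apply: le_trans (lerD (lerD (lexx V) h1) h2) _.
by rewrite le_eqVlt; apply/orP; left; apply/eqP; ring.
Qed.

(** * The mean increment of Q-learning *)

Lemma big_mxvec_index (R : nmodType) (m n : nat) (f : 'I_(m * n) -> R) :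
  \sum_k f k = \sum_i \sum_j f (mxvec_index i j).
Proof.
rewrite (reindex _ (curry_mxvec_bij _ _)) /= pair_bigA.
by apply: eq_bigr => -[].
Qed.

Lemma qvalueE (R : realType) (nS nA p : nat) (Phi : 'M[R]_(nS.+1 * nA.+1, p))
    (v : 'cV[R]_p) s a :
  qvalue Phi v s a = \sum_j feature Phi s a j 0 * v j 0.
Proof. by rewrite /qvalue mxE; apply: eq_bigr => j _; rewrite mxE. Qed.

Lemma mulmx_qvalue (R : realType) (nS nA p : nat)
    (Phi : 'M[R]_(nS.+1 * nA.+1, p)) (v : 'cV[R]_p) s a :
  (Phi *m v) (mxvec_index s a) 0 = qvalue Phi v s a.
Proof. by rewrite qvalueE mxE; apply: eq_bigr => j _; rewrite !mxE. Qed.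

Lemma feature_distr_mulmx (R : realType) (nS nA p : nat)
    (Phi : 'M[R]_(nS.+1 * nA.+1, p)) (d : distr R ('I_nS.+1 * 'I_nA.+1)%type)
    (U : 'cV[R]_(nS.+1 * nA.+1)) (i : 'I_p) :
  (Phi^T *m distr_mx d *m U) i 0 =
  \sum_s \sum_a d (s, a) * U (mxvec_index s a) 0 * feature Phi s a i 0.
Proof.
rewrite mxE big_mxvec_index; apply: eq_bigr => s _; apply: eq_bigr => a _.
by rewrite mul_mx_diag !mxE mxvecE mxE; ring.
Qed.

Definition sample_weight (R : realType) (nS nA : nat) (M : mdp R nS nA)
    (d : distr R ('I_nS.+1 * 'I_nA.+1)%type)
    (x : 'I_nS.+1 * 'I_nA.+1 * 'I_nS.+1) : R :=
  d x.1 * trans M x.1.1 x.1.2 x.2.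

Lemma sum_sample (R : realType) (nS nA : nat) (M : mdp R nS nA)
    (d : distr R ('I_nS.+1 * 'I_nA.+1)%type)
    (f : 'I_nS.+1 * 'I_nA.+1 * 'I_nS.+1 -> R) :
  \sum_x sample_weight M d x * f x =
  \sum_s \sum_a d (s, a) * (\sum_s' trans M s a s' * f (s, a, s')).
Proof.
transitivity (\sum_y \sum_s' sample_weight M d (y, s') * f (y, s')).
  by rewrite pair_bigA /=; apply: eq_bigr => -[].
rewrite [RHS]pair_bigA /=; apply: eq_bigr => -[s a] _; rewrite mulr_sumr.
by apply: eq_bigr => s' _; rewrite mulrA.
Qed.

Lemma sample_weight_ge0 (R : realType) (nS nA : nat) (M : mdp R nS nA)
    (d : distr R ('I_nS.+1 * 'I_nA.+1)%type) x : 0 <= sample_weight M d x.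
Proof. by rewrite mulr_ge0 // dval_ge0. Qed.

Lemma sum_sample_weight (R : realType) (nS nA : nat) (M : mdp R nS nA)
    (d : distr R ('I_nS.+1 * 'I_nA.+1)%type) : \sum_x sample_weight M d x = 1.
Proof.
under eq_bigr do rewrite -[sample_weight _ _ _]mulr1.
rewrite (sum_sample M d (fun=> 1)) pair_bigA /= -[RHS](dval_sum1 d).
apply: eq_bigr => -[s a] _ /=; rewrite -[RHS]mulr1; congr (_ * _).
rewrite -[RHS](dval_sum1 (trans M s a)).
by apply: eq_bigr => ? _; rewrite mulr1.
Qed.

Definition next_value (R : realType) (nS nA p : nat)
    (Phi : 'M[R]_(nS.+1 * nA.+1, p)) (pi : policy R nS nA) (v : 'cV[R]_p)
    (s : 'I_nS.+1) : R :=
  \sum_a pi s a * qvalue Phi v s a.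

Lemma policy_mx_mulmx (R : realType) (nS nA p : nat)
    (Phi : 'M[R]_(nS.+1 * nA.+1, p)) (pi : policy R nS nA) (v : 'cV[R]_p) s :
  (policy_mx pi *m (Phi *m v)) s 0 = next_value Phi pi v s.
Proof.
rewrite mxE big_mxvec_index (bigD1 s) //= [X in _ + X]big1 ?addr0.
  by apply: eq_bigr => a _; rewrite mulmx_qvalue mxE mxvecE mxE eqxx.
move=> s' ss'; apply: big1 => a _.
by rewrite mxE mxvecE mxE (negbTE ss') mul0r.
Qed.

(** Writing the product as a mean over one transition reduces later estimates on [T_mx] to a single
    sample. *)
Lemma T_mx_mulmx (R : realType) (nS nA p : nat) (M : mdp R nS nA)
    (Phi : 'M[R]_(nS.+1 * nA.+1, p)) (pi : policy R nS nA)
    (d : distr R ('I_nS.+1 * 'I_nA.+1)%type) (v : 'cV[R]_p) (i : 'I_p) :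
  (T_mx M Phi pi d *m v) i 0 =
  \sum_x sample_weight M d x *
    ((discount M * next_value Phi pi v x.2 - qvalue Phi v x.1.1 x.1.2) *
     feature Phi x.1.1 x.1.2 i 0).
Proof.
rewrite sum_sample /T_mx mulmxBl -scalemxAl -!mulmxA.
rewrite ![Phi^T *m (distr_mx d *m _)]mulmxA.
rewrite mxE [X in X + _]mxE [X in _ + X]mxE !feature_distr_mulmx.
rewrite mulr_sumr -sumrB; apply: eq_bigr => s _.
rewrite mulr_sumr -sumrB; apply: eq_bigr => a _ /=.
rewrite (mulmx_qvalue Phi) [(transition_mx M *m _) _ _]mxE.
under [X in discount M * (_ * X * _)]eq_bigr do
  rewrite policy_mx_mulmx mxE mxvecE mxE.
set A := \sum_j _.
have -> : \sum_s' trans M s a s' *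
    ((discount M * next_value Phi pi v s' - qvalue Phi v s a) *
     feature Phi s a i 0) =
    (discount M * A - qvalue Phi v s a) * feature Phi s a i 0.
  rewrite -[qvalue Phi v s a in RHS]mul1r -(dval_sum1 (trans M s a)).
  rewrite mulr_sumr mulr_suml -sumrB mulr_suml.
  by apply: eq_bigr => s' _; ring.
by ring.
Qed.

Definition update (R : realType) (nS nA p : nat) (M : mdp R nS nA)
    (Phi : 'M[R]_(nS.+1 * nA.+1, p)) (eta : R)
    (x : 'I_nS.+1 * 'I_nA.+1 * 'I_nS.+1) (theta : 'cV[R]_p) : 'cV[R]_p :=
  (reward M x.1.1 x.1.2 x.2 + discount M * qmax Phi theta x.2
     - qvalue Phi theta x.1.1 x.1.2) *: feature Phi x.1.1 x.1.2
  - eta *: theta.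

Lemma argmaxP (R : realType) (nS nA p : nat)
    (tie : 'I_nS.+1 -> {set 'I_nA.+1} -> 'I_nA.+1)
    (tieP : tie_break_rule tie)
    (Phi : 'M[R]_(nS.+1 * nA.+1, p)) (theta : 'cV[R]_p) s b :
  qvalue Phi theta s b <=
  qvalue Phi theta s (tie s (argmax_set Phi theta s)).
Proof.
suff : tie s (argmax_set Phi theta s) \in argmax_set Phi theta s.
  by rewrite inE => /forallP.
apply: tieP; apply/set0Pn.
exists [arg max_(a > ord0) qvalue Phi theta s a]%O; rewrite inE.
by case: arg_maxP => // a _ amax; apply/forallP => c; apply: amax.
Qed.

Lemma qmaxP (R : realType) (nS nA p : nat)
    (Phi : 'M[R]_(nS.+1 * nA.+1, p)) (theta : 'cV[R]_p) s a :
  (forall b, qvalue Phi theta s b <= qvalue Phi theta s a) ->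
  qmax Phi theta s = qvalue Phi theta s a.
Proof.
move=> amax; apply/eqP; rewrite eq_le; apply/andP; split.
  by apply/bigmax_leP; split.
exact: le_bigmax.
Qed.

Lemma next_value_greedy (R : realType) (nS nA p : nat)
    (tie : 'I_nS.+1 -> {set 'I_nA.+1} -> 'I_nA.+1)
    (Phi : 'M[R]_(nS.+1 * nA.+1, p)) (theta v : 'cV[R]_p) s :
  next_value Phi (greedy tie Phi theta) v s =
  qvalue Phi v s (tie s (argmax_set Phi theta s)).
Proof.
rewrite /next_value (bigD1 (tie s (argmax_set Phi theta s))) //= eqxx mul1r.
by rewrite big1 ?addr0 // => a /negbTE ->; rewrite mul0r.
Qed.

(** The next value under a greedy policy is [qmax] whichever maximizer the tie-breaking rule
    selects, so the discontinuous policy drops out of the mean increment. *)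
Lemma mean_update (R : realType) (nS nA p : nat) (M : mdp R nS nA)
    (Phi : 'M[R]_(nS.+1 * nA.+1, p))
    (tie : 'I_nS.+1 -> {set 'I_nA.+1} -> 'I_nA.+1)
    (tieP : tie_break_rule tie)
    (d : distr R ('I_nS.+1 * 'I_nA.+1)%type) (eta : R) (theta : 'cV[R]_p)
    (i : 'I_p) :
  Feta_vec M Phi eta theta (greedy tie Phi theta) d i 0 =
  \sum_x sample_weight M d x * update M Phi eta x theta i 0.
Proof.
rewrite /Feta_vec /F_vec mxE [X in X + _]mxE [X in _ + X]mxE [X in - X]mxE.
rewrite feature_distr_mulmx T_mx_mulmx.
have -> : \sum_s \sum_a d (s, a) * reward_vec M (mxvec_index s a) 0 *
    feature Phi s a i 0 =
    \sum_x sample_weight M d x *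
      (reward M x.1.1 x.1.2 x.2 * feature Phi x.1.1 x.1.2 i 0).
  rewrite sum_sample; apply: eq_bigr => s _; apply: eq_bigr => a _ /=.
  rewrite mxE mxvecE mxE -mulrA; congr (_ * _); rewrite mulr_suml.
  by apply: eq_bigr => s' _; rewrite mulrA.
rewrite -[eta * _]mul1r -(sum_sample_weight M d) mulr_suml -big_split -sumrB /=.
apply: eq_bigr => x _; rewrite next_value_greedy.
rewrite -(qmaxP (argmaxP tieP Phi theta x.2)) !mxE.
by ring.
Qed.

(** * Analytic tools *)

Lemma cV_norm_le (R : realType) (p : nat) (v : 'cV[R]_p) (N : R) : 0 <= N ->
  (`|v| <= N) <-> (forall i, `|v i 0| <= N).
Proof.
move=> N_ge0; have -> : `|v| = mx_norm v by [].
rewrite mx_normrE; split.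
  by move=> /bigmax_leP[_ vN] i; apply: (vN (i, 0)).
by move=> vN; apply/bigmax_leP; split => // -[i j] _ /=; rewrite (ord1 j).
Qed.

Lemma cV_norm_ge (R : realType) (p : nat) (v : 'cV[R]_p) i :
  `|v i 0| <= `|v|.
Proof. exact: (iffLR (cV_norm_le v (normr_ge0 v)) (lexx _)). Qed.

Lemma mulmx_cV_continuous (R : realType) (m n : nat) (A : 'M[R]_(m, n)) :
  continuous (mulmx A : 'cV[R]_n -> 'cV[R]_m).
Proof.
apply: bounded_linear_continuous; apply/linear_boundedP.
pose K : R := \sum_i \sum_j `|A i j|.
have K_ge0 : 0 <= K by do 2 apply: sumr_ge0 => ? _.
exists K; split; first exact: num_real.
move=> r Kr v; have rv_ge0 : 0 <= r * `|v|.
  by rewrite mulr_ge0 // (le_trans K_ge0) // ltW.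
apply: (iffRL (cV_norm_le (A *m v) rv_ge0)) => i.
rewrite mxE (le_trans (ler_norm_sum _ _ _)) //.
apply: (@le_trans _ _ (K * `|v|)); last by rewrite ler_wpM2r // ltW.
apply: (@le_trans _ _ (\sum_j `|A i j| * `|v|)).
  by apply: ler_sum => j _; rewrite normrM ler_wpM2l // cV_norm_ge.
rewrite -mulr_suml ler_wpM2r // /K (bigD1 i) //= lerDl.
by do 2 apply: sumr_ge0 => ? _.
Qed.

Lemma near_affine_differentiable (R : realType) (V W : normedModType R)
    (F : V -> W) (A : {linear V -> W}) (b : W) (theta : V) : continuous A ->
  (\forall y \near theta, F y = b + A y) -> differentiable F theta.
Proof.
move=> Ac FA; have Ftheta := nbhs_singleton FA.
have dF : F \o shift theta = cst (F theta) + A +o_ 0 id.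
  apply/eqaddoP => _/posnumP[e].
  have : \forall h \near (0 : V), F (theta + h) = b + A (theta + h).
    move: FA; rewrite (near_shift 0) /= subr0; apply: filterS => h.
    by rewrite /= [h + _]addrC.
  apply: filterS => h /= Fh; rewrite -[_ h]/(F (h + theta) - (F theta + A h)).
  rewrite [h + theta]addrC Fh Ftheta linearD addrA subrr normr0.
  by rewrite mulr_ge0.
by apply/diff_locallyP; rewrite (diff_unique Ac dF); split.
Qed.

Lemma lipschitz1_continuous (R : realType) (phi : R -> R) (K : R) :
  (forall x y, `|phi x - phi y| <= K * `|x - y|) -> continuous phi.
Proof.
move=> lip x; apply/cvgrPdist_lt => e e_gt0.
have K_ge0 : 0 <= K.
  have := le_trans (normr_ge0 _) (lip 1 0).
  by rewrite subr0 normr1 mulr1.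
apply/nbhs_normP; exists (e / (K + 1)) => /=.
  by rewrite divr_gt0 // ltr_wpDl.
move=> y; rewrite /= ltr_pdivlMr ?ltr_wpDl // => xy.
apply: le_lt_trans (lip x y) _; apply: le_lt_trans xy.
by rewrite mulrC ler_wpM2l // lerDl.
Qed.

(** Induction on the list: an exceptional point inside the interval splits it in two, and the bounds
    on the halves add up. *)
Lemma MVT_except_finite (R : realType) (phi : R -> R) (c : R) (s : seq R)
    (a b : R) : a <= b -> continuous phi ->
  (forall t, a < t < b -> t \notin s ->
     exists2 l, `|l| <= c & is_derive t 1 phi l) ->
  `|phi b - phi a| <= c * (b - a).
Proof.
move=> + phic; elim: s a b => [|z s IHs] a b ab dphi.
  move: ab; rewrite le_eqVlt => /orP[/eqP ->|ab].
    by rewrite !subrr normr0 mulr0.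
  have dphi' t : t \in `]a, b[%R -> is_derive t 1 phi ('D_1 phi t).
    by rewrite in_itv /= => /dphi[] // l _ dl; rewrite derive_val.
  have [t tab ->] := MVT ab dphi' (continuous_subspaceT phic).
  have ba_ge0 : 0 <= b - a by rewrite subr_ge0 ltW.
  rewrite normrM (ger0_norm ba_ge0); apply: ler_wpM2r => //.
  by move: tab; rewrite in_itv /= => /dphi[] // l lc dl; rewrite derive_val.
have [/andP[az zb]|zab] := boolP (a < z < b); last first.
  apply: IHs => // t tab ts; apply: dphi => //; rewrite inE negb_or ts andbT.
  by apply: contraNneq zab => <-.
have -> : phi b - phi a = (phi b - phi z) + (phi z - phi a) by ring.
have -> : c * (b - a) = c * (b - z) + c * (z - a) by ring.
rewrite (le_trans (ler_normD _ _)) // lerD // IHs ?(ltW az) ?(ltW zb) //.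
  move=> t /andP[zt tb] ts; apply: dphi; first by rewrite (lt_trans az zt).
  by rewrite inE negb_or ts gt_eqF.
move=> t /andP[at_ tz] ts; apply: dphi; first by rewrite at_ (lt_trans tz zb).
by rewrite inE negb_or ts lt_eqF.
Qed.

(** The [size P] distinct points [e / (i + 2)] are more than a nonzero [P] can have as roots. *)
Lemma exists_small_nonroot (R : realType) (P : {poly R}) (e : R) :
  P != 0 -> 0 < e -> exists2 t, 0 < t < e & ~~ root P t.
Proof.
move=> P0 e_gt0; pose pt (i : nat) := e / i.+2%:R.
have pt_in i : 0 < pt i < e.
  rewrite divr_gt0 //= ltr_pdivrMr // ltr_pMr // ltr1n //.
have [/hasP[t /mapP[i _ ->] Pt]|] :=
  boolP (has (fun t => ~~ root P t) (map pt (iota 0 (size P)))).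
  by exists (pt i).
rewrite -all_predC => /allP roots.
have := @max_poly_roots _ P (map pt (iota 0 (size P))) P0.
rewrite size_map size_iota ltnn => H; exfalso; apply: notF; apply: H.
  by apply/allP => t /roots /=; rewrite negbK.
rewrite map_inj_uniq ?iota_uniq // => i j /(mulfI (lt0r_neq0 e_gt0)).
by move=> /invr_inj /eqP; rewrite eqr_nat !eqSS => /eqP.
Qed.

HB.instance Definition _ (R : realType) (p : nat) := Complete.on 'cV[R]_p.

Lemma sup_contraction_fixpoint (R : realType) (p : nat)
    (H : 'cV[R]_p -> 'cV[R]_p) (rho : R) : 0 <= rho < 1 ->
  (forall (y z : 'cV[R]_p) N, (forall i, `|(y - z) i 0| <= N) ->
     forall i, `|(H y - H z) i 0| <= rho * N) ->
  exists z, H z = z.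
Proof.
move=> /andP[rho_ge0 rho_lt1] ctr.
have [|||z _ zH] := @banach_fixed_point R 'cV[R]_p setT (totalfun H).
- exists (NngNum rho_ge0); split => //= -[y z] _ /=.
  apply: (iffRL (cV_norm_le _ _)); first by rewrite mulr_ge0.
  by apply: ctr; exact: cV_norm_ge.
- exact: closedT.
- by exists 0.
- by exists z; rewrite {2}zH.
Qed.

Lemma near_norm_lt (R : realType) (V : normedModType R) (x : V) (e : R)
    (P : V -> Prop) : 0 < e -> (forall y, `|y - x| < e -> P y) ->
  \forall y \near x, P y.
Proof.
move=> e_gt0 xP; apply/nbhs_normP; exists e => //= y xy; apply: xP.
by rewrite distrC.
Qed.

(** * Sup-norm contraction *)

Section sup_norm.
Variables (R : realType) (nS nA p : nat) (M : mdp R nS nA).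
Variables (Phi : 'M[R]_(nS.+1 * nA.+1, p)).
Variables (tie : 'I_nS.+1 -> {set 'I_nA.+1} -> 'I_nA.+1).
Hypothesis tieP : tie_break_rule tie.
Variables (d : distr R ('I_nS.+1 * 'I_nA.+1)%type) (eta : R).
Hypothesis eta_ge0 : 0 <= eta.
Implicit Types (y z v theta : 'cV[R]_p).

Definition mean_field theta : 'cV[R]_p :=
  Feta_vec M Phi eta theta (greedy tie Phi theta) d.

Definition greedy_jacobian theta : 'M[R]_p :=
  T_mx M Phi (greedy tie Phi theta) d - eta%:M.

Definition feature_bound : R := \sum_s \sum_a \sum_j `|feature Phi s a j 0|.

Lemma sum_feature_le s a : \sum_j `|feature Phi s a j 0| <= feature_bound.
Proof.
rewrite /feature_bound (bigD1 s) //= (bigD1 a) //= -addrA lerDl addr_ge0 //.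
  by do 2 apply: sumr_ge0 => ? _.
by do 3 apply: sumr_ge0 => ? _.
Qed.

Lemma feature_le s a j : `|feature Phi s a j 0| <= feature_bound.
Proof.
apply: le_trans (sum_feature_le s a); rewrite (bigD1 j) //= lerDl.
exact: sumr_ge0.
Qed.

Lemma feature_bound_ge0 : 0 <= feature_bound.
Proof. by do 3 apply: sumr_ge0 => ? _. Qed.

Lemma qvalueB y z s a :
  qvalue Phi (y - z) s a = qvalue Phi y s a - qvalue Phi z s a.
Proof. by rewrite /qvalue mulmxBr !mxE. Qed.

Lemma qvalue_le v s a (N : R) : 0 <= N -> (forall i, `|v i 0| <= N) ->
  `|qvalue Phi v s a| <= feature_bound * N.
Proof.
move=> N_ge0 vN; rewrite qvalueE (le_trans (ler_norm_sum _ _ _)) //.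
apply: le_trans (ler_wpM2r N_ge0 (sum_feature_le s a)).
by rewrite mulr_suml; apply: ler_sum => j _; rewrite normrM ler_wpM2l.
Qed.

Lemma qmax_le_add y z s (c : R) :
  (forall a, `|qvalue Phi (y - z) s a| <= c) ->
  qmax Phi y s <= qmax Phi z s + c.
Proof.
move=> yzc; have qc a : qvalue Phi y s a <= qmax Phi z s + c.
  have : qvalue Phi z s a <= qmax Phi z s by apply: le_bigmax.
  by have := le_trans (ler_norm _) (yzc a); rewrite qvalueB; lra.
by apply/bigmax_leP; split.
Qed.

Lemma qmaxB_le y z s (N : R) : 0 <= N -> (forall i, `|(y - z) i 0| <= N) ->
  `|qmax Phi y s - qmax Phi z s| <= feature_bound * N.
Proof.
move=> N_ge0 yzN.
have h1 : qmax Phi y s <= qmax Phi z s + feature_bound * N.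
  by apply: qmax_le_add => a; exact: qvalue_le.
have h2 : qmax Phi z s <= qmax Phi y s + feature_bound * N.
  apply: qmax_le_add => a; apply: qvalue_le => // i.
  by rewrite -opprB mxE normrN.
by rewrite ler_norml; apply/andP; split; lra.
Qed.

(** A sup-norm Lipschitz constant of the update: the temporal difference varies by at most
    [(discount M + 1) * feature_bound * N] and multiplies a feature entry; [eta] comes from the
    regularization. *)
Definition update_bound : R :=
  (discount M + 1) * feature_bound * feature_bound + eta.

Lemma update_bound_ge0 : 0 <= update_bound.
Proof.
rewrite addr_ge0 // !mulr_ge0 ?feature_bound_ge0 // addr_ge0 // ltW //.
exact: discount_gt0.
Qed.

(** Shared by differences of updates, where [b] is a difference of maxima, and by the Jacobian,
    where [b] is the Q-value of the greedy action. *)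
Lemma linear_update_le (N b c phi w : R) : 0 <= N ->
  `|b| <= feature_bound * N -> `|c| <= feature_bound * N ->
  `|phi| <= feature_bound -> `|w| <= N ->
  `|(discount M * b - c) * phi - eta * w| <= update_bound * N.
Proof.
move=> N_ge0 bN cN phiB wN; have g_ge0 := ltW (discount_gt0 M).
have h1 : `|discount M * b - c| <= (discount M + 1) * (feature_bound * N).
  rewrite (le_trans (ler_normB _ _)) // normrM (ger0_norm g_ge0) mulrDl mul1r.
  by apply: lerD => //; exact: ler_wpM2l.
have h2 := ler_pM (normr_ge0 _) (normr_ge0 _) h1 phiB.
have h3 := ler_wpM2l eta_ge0 wN.
rewrite (le_trans (ler_normB _ _)) // !normrM (ger0_norm eta_ge0).
apply: le_trans (lerD h2 h3) _.
by rewrite /update_bound le_eqVlt; apply/orP; left; apply/eqP; ring.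
Qed.

Lemma updateB_le x y z (N : R) : (forall i, `|(y - z) i 0| <= N) ->
  forall i, `|(update M Phi eta x y - update M Phi eta x z) i 0|
    <= update_bound * N.
Proof.
move=> yzN i; have N_ge0 : 0 <= N := le_trans (normr_ge0 _) (yzN i).
have -> : (update M Phi eta x y - update M Phi eta x z) i 0 =
    (discount M * (qmax Phi y x.2 - qmax Phi z x.2) -
     qvalue Phi (y - z) x.1.1 x.1.2) * feature Phi x.1.1 x.1.2 i 0 -
    eta * (y - z) i 0.
  by rewrite qvalueB !mxE; ring.
by apply: linear_update_le; rewrite ?qmaxB_le ?qvalue_le ?feature_le.
Qed.

Lemma mean_norm_le (e : 'I_nS.+1 * 'I_nA.+1 * 'I_nS.+1 -> R) (c : R) :
  (forall x, `|e x| <= c) -> `|\sum_x sample_weight M d x * e x| <= c.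
Proof.
move=> ec; rewrite (le_trans (ler_norm_sum _ _ _)) //.
rewrite -[leRHS]mul1r -(sum_sample_weight M d) mulr_suml.
apply: ler_sum => x _; rewrite normrM ger0_norm ?sample_weight_ge0 //.
by rewrite ler_wpM2l ?sample_weight_ge0.
Qed.

Lemma mean_fieldB_le y z (N : R) : (forall i, `|(y - z) i 0| <= N) ->
  forall i, `|(mean_field y - mean_field z) i 0| <= update_bound * N.
Proof.
move=> yzN i; rewrite mxE [X in _ + X]mxE /mean_field !mean_update // -sumrB.
under eq_bigr do rewrite -mulrBr.
apply: mean_norm_le => x; have := updateB_le x yzN i.
by rewrite mxE [X in _ + X]mxE.
Qed.

Lemma greedy_jacobian_le theta v (N : R) : (forall i, `|v i 0| <= N) ->
  forall i, `|(greedy_jacobian theta *m v) i 0| <= update_bound * N.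
Proof.
move=> vN i; have N_ge0 : 0 <= N := le_trans (normr_ge0 _) (vN i).
rewrite mulmxBl mul_scalar_mx mxE [X in _ + X]mxE [X in - X]mxE T_mx_mulmx.
rewrite -[eta * _]mul1r -(sum_sample_weight M d) mulr_suml -sumrB.
under eq_bigr do rewrite -mulrBr.
apply: mean_norm_le => x; rewrite next_value_greedy.
by apply: linear_update_le; rewrite ?qvalue_le ?feature_le.
Qed.

(** Actions with equal features tie at every [theta]. Exempting them keeps generic points dense, and
    their ties are harmless because their Q-values agree everywhere. *)
Definition generic theta := forall s a b,
  feature Phi s a != feature Phi s b ->
  qvalue Phi theta s a != qvalue Phi theta s b.

(** At [y] only the maximal value counts, so the policy of [theta] may replace that of [y] as long
    as its action is still maximal there. *)
Lemma F_vec_same_greedy theta y :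
  (forall s, qvalue Phi y s (tie s (argmax_set Phi theta s)) =
             qmax Phi y s) ->
  F_vec M Phi y (greedy tie Phi y) d =
  Phi^T *m distr_mx d *m reward_vec M +
    T_mx M Phi (greedy tie Phi theta) d *m y.
Proof.
move=> same; rewrite /F_vec; congr (_ + _).
apply/matrixP => i j; rewrite (ord1 j) !T_mx_mulmx; apply: eq_bigr => x _.
by rewrite !next_value_greedy same (qmaxP (argmaxP tieP Phi y x.2)).
Qed.

(** The selected action beats every action with another feature by a positive gap, while a
    perturbation of size [e] changes a difference of Q-values by at most [2 * feature_bound * e]. *)
Lemma generic_near theta : generic theta ->
  exists2 e : R, 0 < e & forall y, (forall i, `|(y - theta) i 0| <= e) ->
  forall s, qvalue Phi y s (tie s (argmax_set Phi theta s)) = qmax Phi y s.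
Proof.
move=> gen; pose t s := tie s (argmax_set Phi theta s).
pose gap s b := qvalue Phi theta s (t s) - qvalue Phi theta s b.
have [e e_gt0 He] : exists2 e : R, 0 < e & forall s b,
    feature Phi s b != feature Phi s (t s) -> 2 * feature_bound * e < gap s b.
  pose m := \big[Num.min/1]_(x : 'I_nS.+1 * 'I_nA.+1 |
    feature Phi x.1 x.2 != feature Phi x.1 (t x.1)) gap x.1 x.2.
  have m_gt0 : 0 < m.
    rewrite /m; elim/big_ind : _ => // [y z y0 z0|x ne].
      by rewrite lt_min y0.
    rewrite subr_gt0 lt_neqAle gen //=; exact: (argmaxP tieP).
  have B_ge0 := feature_bound_ge0.
  exists (m / (2 * feature_bound + 1)).
    by rewrite divr_gt0 // ltr_wpDl // mulr_ge0.
  move=> s b ne; apply: (@lt_le_trans _ _ m).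
    rewrite mulrA ltr_pdivrMr; last by rewrite ltr_wpDl // mulr_ge0.
    by rewrite mulrC ltr_pM2l // ltrDl.
  by rewrite /m (bigD1 (s, b)) //= ge_min lexx.
exists e => // y ye s; apply/esym/qmaxP => b.
have [eqf|nef] := eqVneq (feature Phi s b) (feature Phi s (t s)).
  by rewrite /qvalue eqf.
have := He s b nef; rewrite /gap.
have := qvalue_le s b (ltW e_gt0) ye.
have := qvalue_le s (t s) (ltW e_gt0) ye.
rewrite !qvalueB !ler_norml => /andP[h1 h2] /andP[h3 h4].
by rewrite -/(t s); lra.
Qed.

(** The bridge to the hypotheses: a negative supremum over [D_lin] controls the Jacobian at all
    generic points. *)
Lemma generic_differentiable theta : generic theta -> D_lin M Phi d tie theta.
Proof.
move=> gen; have [e e_gt0 He] := generic_near gen; rewrite /D_lin /=.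
apply: (near_affine_differentiable
  (A := mulmx (T_mx M Phi (greedy tie Phi theta) d))
  (b := Phi^T *m distr_mx d *m reward_vec M)).
  exact: mulmx_cV_continuous.
apply: (near_norm_lt e_gt0) => y ye; apply: F_vec_same_greedy.
by apply: He => i; rewrite (le_trans (cV_norm_ge _ _)) // ltW.
Qed.

Lemma mean_field_same_greedy theta y :
  (forall s, qvalue Phi y s (tie s (argmax_set Phi theta s)) =
             qmax Phi y s) ->
  mean_field y =
    Phi^T *m distr_mx d *m reward_vec M + greedy_jacobian theta *m y.
Proof.
move=> same; rewrite /mean_field /Feta_vec (F_vec_same_greedy same).
by rewrite /greedy_jacobian [in RHS]mulmxBl mul_scalar_mx addrA.
Qed.

(* Along the moment curve y + (t, t^2, ..., t^p), each difference of Q-values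
   with distinct features is a nonzero polynomial in t. *)
Lemma exists_generic_near y (e : R) : 0 < e ->
  exists2 w, generic w & forall i, `|(w - y) i 0| <= e.
Proof.
move=> e_gt0.
pose u (x : 'I_nS.+1 * 'I_nA.+1 * 'I_nA.+1) : 'cV[R]_p :=
  feature Phi x.1.1 x.1.2 - feature Phi x.1.1 x.2.
pose P x : {poly R} := (\sum_j u x j 0 * y j 0)%:P +
   'X * \poly_(j < p) (if insub j is Some i then u x i 0 else 0).
pose w t : 'cV[R]_p := \col_j (y j 0 + t ^+ j.+1).
have qw t s a b : qvalue Phi (w t) s a - qvalue Phi (w t) s b =
    (P (s, a, b)).[t].
  rewrite hornerD hornerC hornerM hornerX horner_poly mulr_sumr.
  rewrite !qvalueE -sumrB -big_split /=; apply: eq_bigr => j _.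
  rewrite valK /u /w !mxE exprS; ring.
have Pn0 x : u x != 0 -> P x != 0.
  apply: contraNneq => Px0; apply/eqP/matrixP => i j; rewrite (ord1 j) [RHS]mxE.
  have := congr1 (fun Q : {poly R} => Q`_i.+1) Px0.
  by rewrite /P coefD coefC /= add0r coefXM /= coef_poly ltn_ord valK coef0.
pose Q := \prod_(x | u x != 0) P x.
have Qn0 : Q != 0 by apply/prodf_neq0 => x; exact: Pn0.
(* For [t < 1] every power [t ^ j.+1] is at most [t], so all coordinates are bounded at once. *)
have e1_gt0 : 0 < Num.min e 1 by rewrite lt_min e_gt0 ltr01.
have [t /andP[t_gt0 te] Qt] := exists_small_nonroot Qn0 e1_gt0.
move: te; rewrite lt_min => /andP[te t1].
exists (w t).
  move=> s a b; rewrite -subr_eq0 -[in X in _ -> X]subr_eq0 qw => ne.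
  apply: contraNneq Qt => /eqP Pt; rewrite /root /Q horner_prod.
  by apply/prodf_eq0; exists (s, a, b).
move=> i; rewrite !mxE addrC addrA addNr add0r.
rewrite (ger0_norm (exprn_ge0 _ (ltW t_gt0))).
rewrite (le_trans _ (ltW te)) // exprS ler_piMr ?(ltW t_gt0) //.
by rewrite exprn_ile1 // ltW.
Qed.

(** * Contraction of the Euler map *)

Variables (eps h : R).
Hypothesis h_gt0 : 0 < h.
Hypothesis h_small : h * update_bound <= 1.
Hypothesis jacobian_dom : forall theta i, generic theta ->
  row_dom (greedy_jacobian theta) i <= - eps.

Definition euler_map theta : 'cV[R]_p := theta + h *: mean_field theta.

Lemma euler_mapB_le y z (N : R) : (forall i, `|(y - z) i 0| <= N) ->
  forall i, `|(euler_map y - euler_map z) i 0| <= (1 + h * update_bound) * N.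
Proof.
move=> yzN i; have -> : (euler_map y - euler_map z) i 0 =
  (y - z) i 0 + h * (mean_field y - mean_field z) i 0.
  by rewrite /euler_map !mxE; ring.
rewrite (le_trans (ler_normD _ _)) // mulrDl mul1r lerD // normrM.
rewrite (gtr0_norm h_gt0) -mulrA ler_wpM2l ?(ltW h_gt0) //.
exact: mean_fieldB_le.
Qed.

(** Because [h * update_bound <= 1], the diagonal entry [1 + h J_ii] is nonnegative; the absolute
    row sum of [I + h J] is therefore [1 + h S_i(J)], at most [1 - h * eps]. *)
Lemma jacobian_contraction theta v (N : R) : generic theta ->
  (forall i, `|v i 0| <= N) ->
  forall i, `|(v + h *: (greedy_jacobian theta *m v)) i 0| <= (1 - h * eps) * N.
Proof.
move=> gen vN i; have N_ge0 : 0 <= N := le_trans (normr_ge0 _) (vN i).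
set J := greedy_jacobian theta.
have Jii : `|J i i| <= update_bound.
  have := @greedy_jacobian_le theta (delta_mx i 0) 1 _ i.
  rewrite -/J -colE !mxE mulr1; apply=> j; rewrite mxE.
  by case: (_ && _); rewrite ?normr1 ?normr0.
have hJ : 0 <= 1 + h * J i i.
  have := ler_wpM2l (ltW h_gt0) Jii.
  have := ler_norm (- (h * J i i)); rewrite normrN normrM (gtr0_norm h_gt0).
  by have := h_small; lra.
have -> : (v + h *: (J *m v)) i 0 =
    (1 + h * J i i) * v i 0 + h * \sum_(j | j != i) J i j * v j 0.
  by rewrite mxE [X in _ + X]mxE [X in h * X]mxE (bigD1 i) //=; ring.
have h1 : `|(1 + h * J i i) * v i 0| <= (1 + h * J i i) * N.
  by rewrite normrM (ger0_norm hJ) ler_wpM2l.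
have h2 : `|\sum_(j | j != i) J i j * v j 0| <=
    (\sum_(j | j != i) `|J i j|) * N.
  rewrite (le_trans (ler_norm_sum _ _ _)) // mulr_suml.
  by apply: ler_sum => j _; rewrite normrM ler_wpM2l.
rewrite (le_trans (ler_normD _ _)) // [X in _ + X <= _]normrM (gtr0_norm h_gt0).
apply: le_trans (lerD h1 (ler_wpM2l (ltW h_gt0) h2)) _.
have := jacobian_dom i gen; rewrite /row_dom -/J => dom.
have := ler_wpM2r N_ge0 (ler_wpM2l (ltW h_gt0) dom).
by rewrite mulrDr mulrDl; lra.
Qed.

(** Along the line, a tie of two actions with distinct features is an affine equation in [t]. It
    fails at [t = 1], where the point is [w], so it has at most one root, the listed quotient. *)
Lemma segment_generic w y : generic w ->
  exists s : seq R, forall t, t \notin s -> generic (y + t *: (w - y)).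
Proof.
move=> gen.
pose A s a b := qvalue Phi y s a - qvalue Phi y s b.
pose B s a b := qvalue Phi (w - y) s a - qvalue Phi (w - y) s b.
exists [seq - A x.1.1 x.1.2 x.2 / B x.1.1 x.1.2 x.2 |
  x <- enum {: 'I_nS.+1 * 'I_nA.+1 * 'I_nA.+1}] => t ts s a b ne.
have qt c : qvalue Phi (y + t *: (w - y)) s c =
    qvalue Phi y s c + t * qvalue Phi (w - y) s c.
  by rewrite /qvalue mulmxDr -scalemxAr !mxE.
apply: contraNneq ts; rewrite !qt => /eqP; rewrite -subr_eq0.
have -> : qvalue Phi y s a + t * qvalue Phi (w - y) s a -
  (qvalue Phi y s b + t * qvalue Phi (w - y) s b) = A s a b + t * B s a b.
  by rewrite /A /B; ring.
rewrite addr_eq0 => /eqP AB.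
apply/mapP; exists (s, a, b); rewrite ?mem_enum //=.
have [B0|B0] := eqVneq (B s a b) 0; last by rewrite AB opprK mulfK.
have := gen s a b ne; rewrite -subr_eq0.
have -> : qvalue Phi w s a - qvalue Phi w s b = A s a b + B s a b.
  by rewrite /A /B !qvalueB; ring.
by rewrite AB B0 mulr0 oppr0 addr0 eqxx.
Qed.

Lemma euler_map_contraction_generic w y (N : R) : generic w ->
  (forall i, `|(w - y) i 0| <= N) ->
  forall i, `|(euler_map w - euler_map y) i 0| <= (1 - h * eps) * N.
Proof.
move=> gen wyN i; have N_ge0 : 0 <= N := le_trans (normr_ge0 _) (wyN i).
have [s genS] := segment_generic y gen.
set v := w - y in wyN genS.
pose phi t := euler_map (y + t *: v) i 0.
have phic : continuous phi.
  apply: (@lipschitz1_continuous _ _ ((1 + h * update_bound) * N)) => t t'.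
  have -> : phi t - phi t' =
      (euler_map (y + t *: v) - euler_map (y + t' *: v)) i 0.
    by rewrite [RHS]mxE [X in _ = _ + X]mxE.
  rewrite -mulrA [N * _]mulrC; apply: euler_mapB_le => j.
  have -> : (y + t *: v - (y + t' *: v)) j 0 = (t - t') * v j 0.
    by rewrite !mxE; ring.
  by rewrite normrM ler_wpM2l.
have -> : (euler_map w - euler_map y) i 0 = phi 1 - phi 0.
  rewrite /phi scale1r scale0r addr0 (_ : y + v = w); last first.
    by rewrite /v addrC subrK.
  by rewrite mxE [X in _ + X]mxE.
rewrite -[leRHS]mulr1 -[X in _ * X]subr0.
apply: (@MVT_except_finite _ phi _ s) => // t _ ts.
have gent := genS t ts; set th := y + t *: v in gent.
pose J := greedy_jacobian th.
pose l := (v + h *: (J *m v)) i 0.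
exists l; first exact: jacobian_contraction.
have [e e_gt0 He] := generic_near gent.
(* Around a good [t], [phi] coincides with the affine function [c + t' * l], from which its
   derivative is read off. *)
pose c := (y + h *: (Phi^T *m distr_mx d *m reward_vec M + J *m y)) i 0.
apply: (@near_eq_is_derive _ _ _ (fun t' : R => c + t' * l)); last first.
  apply: is_derive_eq.
  by rewrite add0r mul1r scaler0 add0r /GRing.scale /= mulr1.
apply: (@near_norm_lt _ R^o t (e / (N + 1))
  (fun t0 : R => c + t0 * l = phi t0)).
  by rewrite divr_gt0 // ltr_wpDl.
move=> t'; rewrite ltr_pdivlMr ?ltr_wpDl // => tt'.
rewrite /phi /euler_map (mean_field_same_greedy (theta := th)).
  rewrite /c /l -/J (mulmxDr J y (t' *: v)) -(scalemxAr t' J v).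
  clearbody J v; by rewrite !mxE; ring.
apply: He => j; have -> : (y + t' *: v - th) j 0 = (t' - t) * v j 0.
  by rewrite /th !mxE; ring.
rewrite normrM; apply: le_trans (ltW tt').
by rewrite ler_wpM2l // (le_trans (wyN j)) // lerDl.
Qed.

Lemma euler_map_contraction y z (N : R) : (forall i, `|(y - z) i 0| <= N) ->
  forall i, `|(euler_map y - euler_map z) i 0| <= (1 - h * eps) * N.
Proof.
move=> yzN i; apply/ler_addgt0Pr => e e_gt0.
(* The detour through [w] costs [(1 + h * update_bound) * (e / K)] between [y] and [w], and at most
   [|1 - h * eps| * (e / K)] for the longer distance to [z]: [e] in total. The absolute value is
   there since [1 - h * eps] has no known sign yet. *)
pose K := 1 + h * update_bound + `|1 - h * eps|.
have K_gt0 : 0 < K.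
  have := mulr_ge0 (ltW h_gt0) update_bound_ge0.
  by have := normr_ge0 (1 - h * eps); rewrite /K; lra.
have [w genw wy] := exists_generic_near y (divr_gt0 e_gt0 K_gt0).
have wz j : `|(w - z) j 0| <= e / K + N.
  rewrite -[w](subrK y) -addrA mxE (le_trans (ler_normD _ _)) //.
  exact: lerD.
have h1 := euler_map_contraction_generic genw wz i.
have yw j : `|(y - w) j 0| <= e / K by rewrite -opprB mxE normrN.
have h2 := euler_mapB_le yw i.
rewrite -[euler_map y](subrK (euler_map w)) -addrA mxE.
apply: le_trans (ler_normD _ _) _; apply: le_trans (lerD h2 h1) _.
have -> : (1 - h * eps) * N + e =
  (1 - h * eps) * N + (1 + h * update_bound) * (e / K) +
    `|1 - h * eps| * (e / K).
  rewrite -addrA -mulrDl -/K [K * _]mulrC divfK // gt_eqF //.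
have : (1 - h * eps) * (e / K) <= `|1 - h * eps| * (e / K).
  by rewrite ler_wpM2r ?ler_norm // divr_ge0 // ltW.
by rewrite mulrDr; lra.
Qed.

End sup_norm.

(** * Convergence of Q-learning *)

Lemma divergent_tail_sums (R : realType) (alpha : nat -> R) :
  (forall k, 0 <= alpha k) -> (\sum_(0 <= k <oo) (alpha k)%:E = +oo)%E ->
  forall m (A : R), exists n, A <= \sum_(m <= k < n) alpha k.
Proof.
move=> alpha_ge0 alphaoo m A; apply: contrapT => noA.
have a0 k : (0 <= (alpha k)%:E)%E by rewrite lee_fin.
have := alphaoo; rewrite (@nneseries_split _ _ 0 m) // add0n.
have le : (\sum_(m <= k <oo) (alpha k)%:E <= A%:E)%E.
  apply: lime_le; first by apply: is_cvg_nneseries => n _ _.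
  apply: nearW => n; rewrite sumEFin lee_fin leNgt; apply/negP => An.
  by apply: noA; exists n; exact: ltW.
rewrite sumEFin => sumoo.
have : (+oo <= (\sum_(0 <= i < m) alpha i)%:E + A%:E)%E.
  by rewrite -sumoo leeD2l.
by rewrite -EFinD leye_eq.
Qed.

Lemma summable_tail (R : realType) (u : nat -> R) : (forall k, 0 <= u k) ->
  (\sum_(0 <= k <oo) (u k)%:E < +oo)%E ->
  exists tail : nat -> R, [/\ forall k, tail k = u k + tail k.+1,
    forall k, 0 <= tail k &
    forall e : R, 0 < e -> exists N, forall k, (N <= k)%N -> tail k < e].
Proof.
move=> u_ge0 sumu; have u0 k : (0 <= (u k)%:E)%E by rewrite lee_fin.
pose t k := (\sum_(k <= j <oo) (u j)%:E)%E.
have t_ge0 k : (0 <= t k)%E by apply: nneseries_ge0.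
have tS k : t k = ((u k)%:E + t k.+1)%E.
  rewrite /t (@nneseries_split _ _ k 1) // addn1 big_nat1 //.
have t_fin k : t k \is a fin_num.
  rewrite ge0_fin_numE //; apply: le_lt_trans sumu.
  by rewrite [leRHS](@nneseries_split _ _ 0 k) // add0n leeDr // sume_ge0.
exists (fine \o t); split => [k|k|e e_gt0] /=.
- by rewrite tS fineD.
- exact: fine_ge0.
have t0 : t n @[n --> \oo] --> 0%E by apply: (nneseries_tail_cvg sumu).
have /fine_cvgP[_ /cvgrPdist_lt /(_ _ e_gt0)[N _ HN]] := t0.
exists N => k /HN /=; rewrite sub0r normrN ger0_norm //.
exact: fine_ge0.
Qed.

(** [qlearning] unfolds from the last step, [run] from the first; [run_cat] at the last sample
    reconciles them. *)
Lemma qlearning_run (R : realType) (nS nA p : nat) (M : mdp R nS nA)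
    (Phi : 'M[R]_(nS.+1 * nA.+1, p)) (eta : R) (alpha : nat -> R)
    (theta0 : 'cV[R]_p) (X : nat -> 'I_nS.+1 * 'I_nA.+1 * 'I_nS.+1) (n : nat) :
  qlearning M Phi eta alpha theta0 (fun k => (X k).1.1) (fun k => (X k).1.2)
    (fun k => (X k).2) n =
  run (fun k x y => y + alpha k *: update M Phi eta x y) 0 theta0 (mkseq X n).
Proof.
by elim: n => [|n IHn] //; rewrite mkseqS -cats1 run_cat /= size_mkseq -IHn.
Qed.

Lemma law_transitions (R : realType) (disp : measure_display)
    (Omega : measurableType disp) (Pr : probability Omega R) (nS nA : nat)
    (M : mdp R nS nA) (d : distr R ('I_nS.+1 * 'I_nA.+1)%type) s a s' :
  iid_transitions Pr M d s a s' -> forall k x,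
  Pr ((fun w => (s k w, a k w, s' k w)) @^-1` [set x]) =
  (sample_weight M d x)%:E.
Proof.
move=> samples k [[x y] z].
rewrite EFinM -(state_action_law samples k) -(next_state_law samples).
by congr (Pr _); apply/seteqP; split => w /= [-> -> ->].
Qed.

Lemma power_sum_cvg0 (R : realType) (p m : nat) (theta : nat -> 'cV[R]_p)
    (z : 'cV[R]_p) : odd m ->
  (\sum_i ((theta n - z) i 0) ^+ m.+1) @[n --> \oo] --> (0 : R) ->
  theta n @[n --> \oo] --> z.
Proof.
move=> om V0; apply/cvgrPdist_le => e e_gt0.
have em_gt0 : 0 < e ^+ m.+1 by rewrite exprn_gt0.
move/cvgrPdist_lt/(_ _ em_gt0): V0; apply: filterS => n /=.
have evenp i : 0 <= ((theta n - z) i 0) ^+ m.+1.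
  by rewrite exprn_even_ge0 //= om.
rewrite sub0r normrN ger0_norm ?sumr_ge0 // => Ve.
apply: (iffRL (cV_norm_le _ (ltW e_gt0))) => i.
rewrite -(@ler_pXn2r _ m.+1) ?nnegrE ?(ltW e_gt0) //.
apply: ltW; apply: le_lt_trans Ve.
rewrite -opprB mxE normrN -normrX ger0_norm ?evenp // (bigD1 i) //= lerDl.
by apply: sumr_ge0.
Qed.

(** The common core of the three claims. Each supplies dominance at generic points: the tabular one
    everywhere, the others on [D_lin]. *)
Lemma qlearning_cvg (R : realType) (nS nA p : nat) (M : mdp R nS nA)
    (Phi : 'M[R]_(nS.+1 * nA.+1, p))
    (tie : 'I_nS.+1 -> {set 'I_nA.+1} -> 'I_nA.+1)
    (tieP : tie_break_rule tie)
    (d : distr R ('I_nS.+1 * 'I_nA.+1)%type)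
    (disp : measure_display) (Omega : measurableType disp)
    (Pr : probability Omega R)
    (s : nat -> Omega -> 'I_nS.+1) (a : nat -> Omega -> 'I_nA.+1)
    (s' : nat -> Omega -> 'I_nS.+1)
    (samples : iid_transitions Pr M d s a s')
    (alpha : nat -> R)
    (alpha_itv : forall k, 0 < alpha k < 1)
    (alpha_sum : (\sum_(0 <= k <oo) (alpha k)%:E = +oo)%E)
    (alpha_sqr_sum : (\sum_(0 <= k <oo) (alpha k ^+ 2)%:E < +oo)%E)
    (eta : R) (eta_ge0 : 0 <= eta) (theta0 : 'cV[R]_p) (eps : R) :
  0 < eps ->
  (forall theta i, generic Phi theta ->
     row_dom (greedy_jacobian M Phi tie d eta theta) i <= - eps) ->
  exists z : 'cV[R]_p,
    unique (fun t => mean_field M Phi tie d eta t = 0) z /\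
    {ae Pr, forall w,
      qlearning M Phi eta alpha theta0 (s ^~ w) (a ^~ w) (s' ^~ w) k
        @[k --> \oo] --> z}.
Proof.
move=> eps_gt0 dom.
pose K := update_bound M Phi eta.
have K_ge0 : 0 <= K by exact: update_bound_ge0.
(* One choice yields both [h * K <= 1] and [0 <= 1 - h * eps < 1]. *)
pose h := (K + eps + 1)^-1.
have h_gt0 : 0 < h by rewrite invr_gt0; lra.
have hE : h * (K + eps + 1) = 1 by rewrite mulVf // gt_eqF //; lra.
have hK : h * K <= 1 by move: (mulr_gt0 h_gt0 eps_gt0) hE; lra.
have rho01 : 0 <= 1 - h * eps < 1.
  have := mulr_gt0 h_gt0 eps_gt0; have := mulr_ge0 (ltW h_gt0) K_ge0.
  by move: hE; lra.
set rho := 1 - h * eps in rho01.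
have ctr := euler_map_contraction tieP eta_ge0 h_gt0 hK dom.
have [z zH] := sup_contraction_fixpoint rho01 ctr.
have z0 : mean_field M Phi tie d eta z = 0.
  have /eqP := zH; rewrite /euler_map addrC -subr_eq0 addrK scaler_eq0.
  by rewrite gt_eqF //= => /eqP.
exists z; split.
  split => // y y0; apply/eqP; rewrite -subr_eq0 -normr_le0.
  have := ctr z y `|z - y| (@cV_norm_ge _ _ _).
  rewrite zH {1}/euler_map y0 scaler0 addr0 => le.
  have [rho_ge0 rho_lt1] := andP rho01.
  have zy := iffRL (cV_norm_le _ (mulr_ge0 rho_ge0 (normr_ge0 (z - y)))) le.
  have : (1 - rho) * `|z - y| <= 0 by rewrite mulrBl mul1r subr_le0.
  by rewrite pmulr_rle0 // subr_gt0.
pose X k w := (s k w, a k w, s' k w).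
(* Linear growth about [z]: the Lipschitz constant plus a bound on the finitely many updates at [z]
   itself. *)
pose L := K + \sum_x \sum_i `|update M Phi eta x z i 0|.
have L0_ge0 : 0 <= \sum_x \sum_i `|update M Phi eta x z i 0|.
  by do 2 apply: sumr_ge0 => ? _.
have L_ge0 : 0 <= L by rewrite addr_ge0.
have growth x y N : (forall i, `|(y - z) i 0| <= N) ->
    forall i, `|update M Phi eta x y i 0| <= L * (1 + N).
  move=> yzN i; have N_ge0 : 0 <= N := le_trans (normr_ge0 _) (yzN i).
  have := updateB_le M Phi eta_ge0 x yzN i; rewrite mxE [X in _ + X]mxE -/K.
  have : `|update M Phi eta x z i 0| <=
      \sum_x \sum_i `|update M Phi eta x z i 0|.
    rewrite (bigD1 x) //= (bigD1 i) //= -addrA lerDl addr_ge0 //.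
      exact: sumr_ge0.
    by do 2 apply: sumr_ge0 => ? _.
  rewrite /L; move: L0_ge0; set L0 := \sum_x _ => L0_ge0.
  have := ler_normD (update M Phi eta x y i 0 - update M Phi eta x z i 0)
    (update M Phi eta x z i 0).
  rewrite subrK; have := mulr_ge0 L0_ge0 N_ge0.
  have -> : (K + L0) * (1 + N) = K + K * N + L0 + L0 * N by ring.
  by move: K_ge0; lra.
have contr y N : (forall i, `|(y - z) i 0| <= N) -> forall i,
    `|(y - z) i 0 + h * (\sum_x sample_weight M d x * update M Phi eta x y i 0)|
      <= rho * N.
  move=> yzN i; have := ctr y z N yzN i; rewrite zH /euler_map -/rho.
  rewrite -(mean_update M Phi tieP) -/(mean_field M Phi tie d eta y).
  have -> : (y + h *: mean_field M Phi tie d eta y - z) i 0 =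
    (y - z) i 0 + h * mean_field M Phi tie d eta y i 0.
    by rewrite !mxE; ring.
  by [].
have [m [c [C [om c_gt0 C_ge0 drift]]]] :=
  lyapunov_drift (@sample_weight_ge0 _ _ _ M d) (sum_sample_weight M d)
    h_gt0 rho01 L_ge0 growth contr.
have [tail [tailS tail_ge0 tail0]] :=
  summable_tail (fun k => sqr_ge0 (alpha k)) alpha_sqr_sum.
have alpha_ge0 k : 0 <= alpha k by case/andP: (alpha_itv k) => /ltW.
(* Half of the decrease [c * alpha k] absorbs the term [C * alpha k ^+ 2] multiplying [V] once
   [alpha k] is small, which follows from [alpha k ^+ 2 <= tail k]. *)
have [N HN] : exists N, forall k, (N <= k)%N -> C * alpha k <= c / 2.
  pose b := c / 2 / (C + 1).
  have b_gt0 : 0 < b by rewrite !divr_gt0 //; lra.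
  have [N HN] := tail0 (b ^+ 2) (exprn_gt0 _ b_gt0).
  exists N => k /HN tk; have ab : alpha k <= b.
    rewrite -(@ler_pXn2r _ 2) ?nnegrE ?(ltW b_gt0) //.
    by move: tk (tail_ge0 k.+1); rewrite (tailS k); lra.
  have : (C + 1) * alpha k <= c / 2.
    by rewrite mulrC -ler_pdivlMr //; lra.
  by have := alpha_ge0 k; lra.
have c2_gt0 : 0 < c / 2 by lra.
have drift' k y : (N <= k)%N ->
    \sum_x sample_weight M d x *
      (\sum_i ((y + alpha k *: update M Phi eta x y - z) i 0) ^+ m.+1) <=
    (1 - c / 2 * alpha k) * (\sum_i ((y - z) i 0) ^+ m.+1) + C * alpha k ^+ 2.
  move=> Nk; apply: (le_trans (drift y (alpha k) _)).
    by case/andP: (alpha_itv k) => /ltW -> /ltW ->.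
  rewrite lerD2r; apply: ler_wpM2r.
    by apply: sumr_ge0 => i _; rewrite exprn_even_ge0 //= om.
  by have := ler_wpM2r (alpha_ge0 k) (HN k Nk); lra.
have V_ge0 (y : 'cV[R]_p) : 0 <= \sum_i ((y - z) i 0) ^+ m.+1.
  by apply: sumr_ge0 => i _; rewrite exprn_even_ge0 //= om.
have := ae_run_cvg0 (X := X) theta0 (transitions_rv samples)
  (transitions_indep samples) (law_transitions samples)
  (sum_sample_weight M d) c2_gt0 C_ge0 V_ge0 tailS tail_ge0 alpha_ge0 tail0
  (divergent_tail_sums alpha_ge0 alpha_sum) drift'.
apply: filterS => w V0; apply: (power_sum_cvg0 om).
rewrite (_ : (fun n => _) = (fun n => \sum_i
  ((run (fun k x y => y + alpha k *: update M Phi eta x y) 0 theta0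
     (mkseq (X ^~ w) n) - z) i 0) ^+ m.+1)) //.
by apply/funext => n; rewrite -(qlearning_run M Phi eta alpha theta0 (X ^~ w)).
Qed.

Lemma ereal_sup_row_dom_lt0 (R : realType) (p : nat) (U : Type) (D : set U)
    (A : U -> 'M[R]_p) :
  (ereal_sup [set max_row_dom (A t) | t in D] < 0)%E ->
  exists2 eps : R, 0 < eps & forall t i, D t -> row_dom (A t) i <= - eps.
Proof.
set r := ereal_sup _ => r_lt0.
have Ar t i : D t -> ((row_dom (A t) i)%:E <= r)%E.
  move=> Dt; apply: (@le_trans _ _ (max_row_dom (A t))); first exact: le_bigmax.
  by apply: ereal_sup_ubound; exists t.
case: r r_lt0 Ar => [r|//|_ Ar]; first rewrite lte_fin => r_lt0 Ar.
  exists (- r); first by rewrite oppr_gt0.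
  by move=> t i /(Ar _ i); rewrite opprK lee_fin.
(* A supremum [-oo] lies below every real [row_dom], so no pair of a point of [D] and an index
   exists and any [eps] works. *)
by exists 1 => // t i /(Ar _ i); rewrite leeNy_eq.
Qed.

Lemma greedy_jacobian0 (R : realType) (nS nA p : nat) (M : mdp R nS nA)
    (Phi : 'M[R]_(nS.+1 * nA.+1, p))
    (tie : 'I_nS.+1 -> {set 'I_nA.+1} -> 'I_nA.+1)
    (d : distr R ('I_nS.+1 * 'I_nA.+1)%type) (theta : 'cV[R]_p) :
  greedy_jacobian M Phi tie d 0 theta = T_mx M Phi (greedy tie Phi theta) d.
Proof. by rewrite /greedy_jacobian raddf0 subr0. Qed.

Lemma mean_field0 (R : realType) (nS nA p : nat) (M : mdp R nS nA)
    (Phi : 'M[R]_(nS.+1 * nA.+1, p))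
    (tie : 'I_nS.+1 -> {set 'I_nA.+1} -> 'I_nA.+1)
    (d : distr R ('I_nS.+1 * 'I_nA.+1)%type) (theta : 'cV[R]_p) :
  mean_field M Phi tie d 0 theta = F_vec M Phi theta (greedy tie Phi theta) d.
Proof. by rewrite /mean_field /Feta_vec scale0r subr0. Qed.

(* The off-diagonal entries are nonnegative, so S_i is the i-th row sum,
   which is read off the action on the constant vector 1. *)
Lemma tabular_row_dom (R : realType) (nS nA : nat) (M : mdp R nS nA)
    (tie : 'I_nS.+1 -> {set 'I_nA.+1} -> 'I_nA.+1)
    (d : distr R ('I_nS.+1 * 'I_nA.+1)%type)
    (theta : 'cV[R]_(nS.+1 * nA.+1)) s a :
  row_dom (T_mx M 1%:M (greedy tie 1%:M theta) d) (mxvec_index s a) =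
  - ((1 - discount M) * d (s, a)).
Proof.
set T := T_mx _ _ _ _; set k := mxvec_index s a.
have featE x y j : feature (1%:M : 'M[R]_(nS.+1 * nA.+1)) x y j 0 =
    (mxvec_index x y == j)%:R by rewrite !mxE.
have qdelta j x y : qvalue 1%:M (delta_mx j 0 : 'cV[R]__) x y =
    (mxvec_index x y == j)%:R.
  by rewrite -mulmx_qvalue mul1mx mxE eqxx andbT.
have T_ge0 j : j != k -> 0 <= T k j.
  move=> jk; have -> : T k j = (T *m (delta_mx j 0 : 'cV_(nS.+1 * nA.+1))) k 0.
    by rewrite -colE [RHS]mxE.
  rewrite T_mx_mulmx; apply: sumr_ge0 => x _.
  apply: mulr_ge0; first exact: sample_weight_ge0.
  rewrite next_value_greedy !qdelta featE.
  (* The feature is nonzero only when the visited pair is [k]; since [j] differs from [k], the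
     negative term then vanishes. *)
  have [->|_] := eqVneq (mxvec_index x.1.1 x.1.2) k; last by rewrite mulr0.
  rewrite [k == j]eq_sym (negbTE jk) subr0 mulr1 mulr_ge0 // ltW //.
  exact: discount_gt0.
have -> : row_dom T k = (T *m (const_mx 1 : 'cV_(nS.+1 * nA.+1))) k 0.
  rewrite /row_dom [RHS]mxE [RHS](bigD1 k) //= [const_mx _ _ _]mxE mulr1.
  congr (_ + _); apply: eq_bigr => j jk.
  by rewrite [const_mx _ _ _]mxE mulr1 ger0_norm // T_ge0.
have q1 x y : qvalue 1%:M (const_mx 1 : 'cV[R]__) x y = 1.
  by rewrite -mulmx_qvalue mul1mx mxE.
rewrite T_mx_mulmx.
(* On the constant vector every Q-value is one, so a sample contributes [discount M - 1] if it
   visits [(s, a)] and zero otherwise. *)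
under eq_bigr => x _ do rewrite next_value_greedy !q1 featE mulr1 mulrCA.
rewrite -mulr_sumr sum_sample pair_bigA /= (bigD1 (s, a)) //=.
rewrite [X in _ * (_ + X)]big1 ?addr0.
  by under eq_bigr do rewrite eqxx mulr1; rewrite dval_sum1 mulr1; ring.
move=> [x y] ne; rewrite big1 ?mulr0 // => s' _ /=.
case: eqP => [|_]; last by rewrite mulr0.
by move=> /cast_ord_inj/enum_rank_inj xy; rewrite xy eqxx in ne.
Qed.

Theorem proposition4p4 (R : realType) (nS nA p : nat) (M : mdp R nS nA)
    (Phi : 'M[R]_(nS.+1 * nA.+1, p))
    (tie : 'I_nS.+1 -> {set 'I_nA.+1} -> 'I_nA.+1)
    (tieP : tie_break_rule tie)
    (d : distr R ('I_nS.+1 * 'I_nA.+1)%type)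
    (d_gt0 : forall s a, 0 < d (s, a))
    (disp : measure_display) (Omega : measurableType disp)
    (Pr : probability Omega R)
    (s : nat -> Omega -> 'I_nS.+1) (a : nat -> Omega -> 'I_nA.+1)
    (s' : nat -> Omega -> 'I_nS.+1)
    (samples : iid_transitions Pr M d s a s')
    (alpha : nat -> R)
    (alpha_itv : forall k, 0 < alpha k < 1)
    (alpha_sum : (\sum_(0 <= k <oo) (alpha k)%:E = +oo)%E)
    (alpha_sqr_sum : (\sum_(0 <= k <oo) (alpha k ^+ 2)%:E < +oo)%E)
    (eta : R) (eta_ge0 : 0 <= eta) (theta0 : 'cV[R]_p) :
  let theta (k : nat) (w : Omega) : 'cV[R]_p :=
    qlearning M Phi eta alpha theta0 (s ^~ w) (a ^~ w) (s' ^~ w) k in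
  let pi := greedy tie Phi in
  let converges_as (theta_star : 'cV[R]_p) :=
    {ae Pr, forall w, theta k w @[k --> \oo] --> theta_star} in
  [/\ (forall Ep : (nS.+1 * nA.+1)%N = p,
         Phi = castmx (erefl, Ep) 1%:M -> eta = 0 ->
         exists theta_star : 'cV[R]_p,
           unique (fun t => F_vec M Phi t (pi t) d = 0) theta_star /\
           converges_as theta_star),
      (eta = 0 ->
         (ereal_sup [set max_row_dom (T_mx M Phi (pi t) d)
                    | t in D_lin M Phi d tie] < 0)%E ->
         exists theta_star : 'cV[R]_p,
           unique (fun t => F_vec M Phi t (pi t) d = 0) theta_star /\
           converges_as theta_star)
    & (0 < eta ->
         (ereal_sup [set max_row_dom (T_mx M Phi (pi t) d - eta%:M)
                    | t in D_lin M Phi d tie] < 0)%E ->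
         exists theta_star : 'cV[R]_p,
           unique (fun t => Feta_vec M Phi eta t (pi t) d = 0) theta_star /\
           converges_as theta_star)].
Proof.
move=> theta pi converges_as; split.
- move=> Ep PhiE eta0; subst p; rewrite castmx_id in PhiE; subst eta Phi.
  (* A minimum over finitely many pairs turns [d_gt0] into the uniform margin
     [(1 - discount M) * m]; the initial value 1 is harmless, as only [0 < m] and [m <= d (x, y)]
     are used. *)
  pose m := \big[Num.min/1]_(x : 'I_nS.+1 * 'I_nA.+1) d x.
  have m_gt0 : 0 < m.
    rewrite /m; elim/big_ind : _ => // [y z y0 z0|[x y] _].
      by rewrite lt_min y0.
    exact: d_gt0.
  have eps_gt0 : 0 < (1 - discount M) * m.
    by rewrite mulr_gt0 // subr_gt0 discount_lt1.
  have [|z [[z0 zU] zcvg]] := qlearning_cvg tieP samples alpha_itv alpha_sum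
    alpha_sqr_sum (lexx 0) theta0 eps_gt0 (Phi := 1%:M).
    move=> t i _; rewrite greedy_jacobian0.
    case/mxvec_indexP: i => x y; rewrite tabular_row_dom lerN2 ler_wpM2l //.
      by rewrite subr_ge0 ltW // discount_lt1.
    by rewrite /m (bigD1 (x, y)) //= ge_min lexx.
  exists z; split=> //; split; first by rewrite -mean_field0.
  by move=> y y0; apply: zU; rewrite mean_field0.
- move=> eta0 /ereal_sup_row_dom_lt0[eps eps_gt0 dom]; subst eta.
  have [|z [[z0 zU] zcvg]] := qlearning_cvg tieP samples alpha_itv alpha_sum
    alpha_sqr_sum (lexx 0) theta0 eps_gt0 (Phi := Phi).
    move=> t i gen; rewrite greedy_jacobian0.
    exact/dom/generic_differentiable.
  exists z; split=> //; split; first by rewrite -mean_field0.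
  by move=> y y0; apply: zU; rewrite mean_field0.
- move=> eta_gt0 /ereal_sup_row_dom_lt0[eps eps_gt0 dom].
  apply: (qlearning_cvg tieP samples alpha_itv alpha_sum alpha_sqr_sum eta_ge0
    theta0 eps_gt0) => t i gen.
  exact/dom/generic_differentiable.
Qed.
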